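(* Let $d\ge 1$. Every function $f\in\mathcal{F}^d_{\mathrm{TC}}$ is totally concave in the sense of Popoviciu, i.e. $f\in\mathcal{F}^d_{\mathrm{TCP}}$. Also, every function $f\in\mathcal{F}^d_{\mathrm{TCP}}$ satisfying the following two regularity conditions for each nonempty subset $S$ of $[d]$ belongs to $\mathcal{F}^d_{\mathrm{TC}}$: $$\sup_{t_k>0,\,k\in S}\Big\{\frac{1}{\prod_{k\in S}t_k}\sum_{R\subseteq S}(-1)^{|S|-|R|} f\Big(\big(t_k\cdot\mathbf{1}\{k\in R\}\big)_{k=1}^d\Big)\Big\}<+\infty,$$ $$\inf_{t_k<1,\,k\in S}\Big\{\frac{1}{\prod_{k\in S}(1-t_k)}\sum_{R\subseteq S}(-1)^{|S|-|R|} f\Big(\big(\mathbf{1}\{k\in R\}+t_k\cdot\mathbf{1}\{k\in S\setminus R\}\big)_{k=1}^d\Big)\Big\}>-\infty,$$ where in both conditions the $t_k$ ($k\in S$) range over points of $[0,1]$ with the indicated strict inequality.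
   Context: $[d]=\{1,\dots,d\}$, $\mathbf 0=(0,\dots,0)$, $(x)_+=\max(x,0)$, and $(a_k)_{k=1}^d$ denotes the vector with $k$-th component $a_k$. $\mathcal{F}^d_{\mathrm{TC}}$ is the class of all functions $f:[0,1]^d\to\mathbb{R}$ of the form $$f(x_1,\dots,x_d)=\beta_0+\sum_{\emptyset\ne S\subseteq[d]}\beta_S\prod_{j\in S}x_j-\sum_{\emptyset\neq S\subseteq[d]}\int_{[0,1)^{|S|}\setminus\{\mathbf 0\}}\prod_{j\in S}(x_j-t_j)_+\,d\nu_S(t_j,j\in S),$$ where $\beta_0,\beta_S\in\mathbb{R}$ and each $\nu_S$ is a finite (nonnegative) Borel measure on $[0,1)^{|S|}\setminus\{\mathbf 0\}$. $\mathcal{F}^d_{\mathrm{TCP}}$ (functions totally concave in the sense of Popoviciu) is the class of all $f:[0,1]^d\to\mathbb{R}$ such that for every $(p_1,\dots,p_d)\in\mathbb{Z}_{\ge0}^d$ with $\max_k p_k=2$, $$\sum_{i_1=1}^{p_1+1}\cdots\sum_{i_d=1}^{p_d+1}\frac{f(x^{(1)}_{i_1},\dots,x^{(d)}_{i_d})}{\prod_{j_1\ne i_1}(x^{(1)}_{i_1}-x^{(1)}_{j_1})\times\cdots\times\prod_{j_d\neq i_d}(x^{(d)}_{i_d}-x^{(d)}_{j_d})}\le 0$$ for all $0\le x^{(k)}_1<\cdots<x^{(k)}_{p_k+1}\le1$, $k=1,\dots,d$ (empty products equal 1). *)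

(* Defs.v *)
From HB Require Import structures.
From mathcomp Require Import all_boot all_order all_algebra.
From mathcomp Require Import all_classical all_reals all_analysis.

Set Implicit Arguments.
Unset Strict Implicit.
Unset Printing Implicit Defensive.

Import Order.TTheory GRing.Theory Num.Theory.

Local Open Scope classical_set_scope.
Local Open Scope ring_scope.

(* A function [0,1]^d -> R is represented by a total function on d-tuples; every
   notion below depends only on its values on the cube. *)

Definition cube (R : realType) (d : nat) : set (d.-tuple R) :=
  [set x | forall k : 'I_d, 0 <= tnth x k <= 1].

(* [0,1)^n \ {0} *)
Definition punctured_cube (R : realType) (n : nat) : set (n.-tuple R) :=
  [set t | (forall i : 'I_n, 0 <= tnth t i < 1) /\
           (exists i : 'I_n, tnth t i != 0)].

(* The coordinates of a point of R^S are listed along the increasing enumeration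
   of S, the i-th one being that of index enum_val i \in S.  The sigma-algebra on
   n.-tuple R is the one generated by the coordinate projections, that is, the
   Borel one.  A finite Borel measure on punctured_cube is given as a finite Borel
   measure on the whole space R^S; its values off punctured_cube are irrelevant,
   since it is only integrated over punctured_cube. *)
Definition totally_concave (R : realType) (d : nat) (f : d.-tuple R -> R) : Prop :=
  exists (beta0 : R) (beta : {set 'I_d} -> R)
    (nu : forall S : {set 'I_d}, {finite_measure set (#|S|.-tuple R) -> \bar R}),
    forall x : d.-tuple R, cube x ->
      f x = beta0
          + \sum_(S : {set 'I_d} | S != finset.set0)
              beta S * \prod_(j in S) tnth x j
          - \sum_(S : {set 'I_d} | S != finset.set0)
              \int[nu S]_(t in @punctured_cube R #|S|)
                \prod_(i < #|S|) Num.max (tnth x (enum_val i) - tnth t i) 0.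

(* The divided difference of order p of f at the nodes x k 0, ..., x k (p k),
   k < d; the sum ranges over all multi-indices i with i k <= p k. *)
Definition divided_difference (R : realType) (d : nat) (f : d.-tuple R -> R)
    (p : 'I_d -> nat) (x : forall k : 'I_d, 'I_(p k).+1 -> R) : R :=
  \sum_(i : {dffun forall k : 'I_d, 'I_(p k).+1})
    f [tuple x k (i k) | k < d] /
    \prod_(k < d) \prod_(j < (p k).+1 | j != i k) (x k (i k) - x k j).

Definition totally_concave_Popoviciu (R : realType) (d : nat)
    (f : d.-tuple R -> R) : Prop :=
  forall p : 'I_d -> nat, (\max_(k < d) p k = 2)%N ->
  forall x : (forall k : 'I_d, 'I_(p k).+1 -> R),
    (forall k i, 0 <= x k i <= 1) ->
    (forall k (i j : 'I_(p k).+1), (i < j)%N -> x k i < x k j) ->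
    divided_difference f x <= 0.

(* In the next two definitions only the coordinates t_k with k \in S matter. *)
Definition quotient_at_zero (R : realType) (d : nat) (f : d.-tuple R -> R)
    (S : {set 'I_d}) (t : d.-tuple R) : R :=
  (\prod_(k in S) tnth t k)^-1 *
  \sum_(Q : {set 'I_d} | Q \subset S)
    (-1) ^+ (#|S| - #|Q|) * f [tuple tnth t k * (k \in Q)%:R | k < d].

Definition quotient_at_one (R : realType) (d : nat) (f : d.-tuple R -> R)
    (S : {set 'I_d}) (t : d.-tuple R) : R :=
  (\prod_(k in S) (1 - tnth t k))^-1 *
  \sum_(Q : {set 'I_d} | Q \subset S)
    (-1) ^+ (#|S| - #|Q|) *
    f [tuple (k \in Q)%:R + tnth t k * (k \in S :\: Q)%:R | k < d].

(* Main.v *)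
(** On a finite grid containing 0 and 1, piecewise multilinear interpolation
    writes f, at the grid points, as a constant plus multiples of the monomials
    [\prod_(j in S) x_j] minus a combination of the hinge products
    [\prod_(j in S) (x_j - t_j)_+] with t <> 0 in the grid. The coefficients are
    divided differences of order at most 2 in each coordinate, so total
    concavity makes those of the hinge products nonnegative, and they sum to
    [quotient_at_zero - quotient_at_one], which the regularity conditions bound
    uniformly in the grid. Along an ultrafilter on the grids for which each
    point of [0,1] is eventually a node, the identity passes to the limit at all
    points at once, without continuity of f. The limiting sums are positive
    functionals on bounded functions, represented on continuous ones by a finite
    measure on the closed cube. Its mass at 0 only changes the coefficient of
    the monomial, and its mass on the faces t_j = 1 is invisible to the hinge
    products. *)

From HB Require Import structures.
Require Import Defs.
From mathcomp Require Import all_boot all_order all_algebra.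
From mathcomp Require Import all_classical all_reals all_analysis.
From mathcomp Require Import measurable_realfun ring lra zify.

Set Implicit Arguments.
Unset Strict Implicit.
Unset Printing Implicit Defensive.

Import Order.TTheory GRing.Theory Num.Theory.
Import numFieldNormedType.Exports.

Local Open Scope classical_set_scope.
Local Open Scope ring_scope.

(** * Positive functionals on bounded functions on the cube *)

Section positive_functional.
Context {R : realType} {n : nat}.
Implicit Types (h g : n.-tuple R -> R) (x : n.-tuple R).

Definition bounded_on_cube h := exists C, forall x, cube x -> `|h x| <= C.

Definition uniformly_continuous_on_cube h := forall e : R, 0 < e ->
  exists2 r : R, 0 < r & forall x y, cube x -> cube y ->
    (forall k, `|tnth x k - tnth y k| <= r) -> `|h x - h y| <= e.

Record positive_functional (L : (n.-tuple R -> R) -> R) : Prop := {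
  pf_linear : forall a g h, bounded_on_cube g -> bounded_on_cube h ->
    L (fun x => a * g x + h x) = a * L g + L h;
  pf_ge0 : forall h, bounded_on_cube h -> (forall x, cube x -> 0 <= h x) ->
    0 <= L h }.

Lemma bounded_on_cube_cst c : bounded_on_cube (fun=> c).
Proof. by exists `|c|. Qed.

Lemma bounded_on_cube_bool (p : n.-tuple R -> bool) :
  bounded_on_cube (fun x => (p x)%:R).
Proof. by exists 1 => x _; case: (p x); rewrite ?normr1 ?normr0. Qed.

Lemma bounded_on_cube_linear a g h : bounded_on_cube g -> bounded_on_cube h ->
  bounded_on_cube (fun x => a * g x + h x).
Proof.
move=> [C gC] [D hD]; exists (`|a| * C + D) => x xc.
by rewrite (le_trans (ler_normD _ _))// normrM lerD ?ler_wpM2l ?gC ?hD.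
Qed.

Lemma bounded_on_cube_sum (I : Type) (r : seq I) (a : I -> R)
    (g_ : I -> n.-tuple R -> R) : (forall i, bounded_on_cube (g_ i)) ->
  bounded_on_cube (fun x => \sum_(i <- r) a i * g_ i x).
Proof.
move=> gb; elim: r => [|i r IH].
  by under eq_fun do rewrite big_nil; exact: bounded_on_cube_cst.
by under eq_fun do rewrite big_cons; exact: bounded_on_cube_linear.
Qed.

Variable L : (n.-tuple R -> R) -> R.
Hypothesis Lpos : positive_functional L.

Lemma pf_zero : L (fun=> 0) = 0.
Proof.
have := pf_linear Lpos 1 (bounded_on_cube_cst 0) (bounded_on_cube_cst 0).
by under eq_fun do rewrite mul1r addr0; lra.
Qed.

Lemma pf_sub g h : bounded_on_cube g -> bounded_on_cube h ->
  L (fun x => g x - h x) = L g - L h.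
Proof.
move=> gb hb; rewrite addrC -mulN1r -(pf_linear Lpos)//; congr L.
by apply/funext => x; rewrite mulN1r addrC.
Qed.

Lemma bounded_on_cube_sub g h : bounded_on_cube g -> bounded_on_cube h ->
  bounded_on_cube (fun x => g x - h x).
Proof.
move=> gb hb; have := bounded_on_cube_linear (-1) hb gb.
by under eq_fun do rewrite mulN1r addrC.
Qed.

Lemma pf_le g h : bounded_on_cube g -> bounded_on_cube h ->
  (forall x, cube x -> g x <= h x) -> L g <= L h.
Proof.
move=> gb hb gh; rewrite -subr_ge0 -pf_sub//.
apply: (pf_ge0 Lpos) => [|x xc]; first exact: bounded_on_cube_sub.
by rewrite subr_ge0 gh.
Qed.

Lemma pf_eq g h : bounded_on_cube g -> bounded_on_cube h ->
  (forall x, cube x -> g x = h x) -> L g = L h.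
Proof.
by move=> gb hb gh; apply/eqP; rewrite eq_le !pf_le// => x xc; rewrite gh.
Qed.

Lemma pf_sum (I : Type) (r : seq I) (a : I -> R) (g_ : I -> n.-tuple R -> R) :
  (forall i, bounded_on_cube (g_ i)) ->
  L (fun x => \sum_(i <- r) a i * g_ i x) = \sum_(i <- r) a i * L (g_ i).
Proof.
move=> gb; elim: r => [|i r IH].
  by under eq_fun do rewrite big_nil; rewrite big_nil pf_zero.
under eq_fun do rewrite big_cons.
by rewrite big_cons (pf_linear Lpos) ?IH//; exact: bounded_on_cube_sum.
Qed.

Lemma pf_scale c : L (fun=> c) = c * L (fun=> 1).
Proof.
rewrite -[RHS]addr0 -pf_zero -(pf_linear Lpos); try exact: bounded_on_cube_cst.
by congr L; apply/funext => x; rewrite mulr1 addr0.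
Qed.

Lemma pf_norm_le h C : (forall x, cube x -> `|h x| <= C) ->
  `|L h| <= C * L (fun=> 1).
Proof.
move=> hC; have hb : bounded_on_cube h by exists C.
have cb c := bounded_on_cube_cst c.
rewrite ler_norml -mulNr -!pf_scale !pf_le// => x /hC; rewrite ler_norml.
  by case/andP.
by case/andP.
Qed.

End positive_functional.

(** * Hinge products and integrals over the cube *)

Definition hinge {R : realType} n (z : 'I_n -> R) (t : n.-tuple R) : R :=
  \prod_(a < n) Num.max (z a - tnth t a) 0.

Section cube_integrals.
Context {R : realType} {n : nat}.
Implicit Types (z : 'I_n -> R) (t : n.-tuple R).

Lemma measurable_tuple_box (J : 'I_n -> interval R) :
  measurable [set t : n.-tuple R | forall k, tnth t k \in J k].
Proof.
rewrite (_ : [set t | _] = \bigcap_(k in [set: 'I_n])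
    ((@tnth _ R ^~ k) @^-1` [set` J k])).
  apply: fin_bigcap_measurable => // k _.
  rewrite -[X in measurable X]setTI; apply: (@measurable_tnth _ R n k) => //.
by apply/seteqP; split => t tJ k; [move=> _|]; exact: tJ.
Qed.

Lemma measurable_cube : measurable (@cube R n).
Proof.
rewrite (_ : @cube R n = [set t | forall k, tnth t k \in `[0, 1]%R]).
  exact: measurable_tuple_box.
by apply/seteqP; split => t tc k; have := tc k; rewrite in_itv.
Qed.

Lemma measurable_tuple1 t : measurable [set t].
Proof.
rewrite (_ : [set t] =
    [set s | forall k, tnth s k \in `[tnth t k, tnth t k]%R]).
  exact: measurable_tuple_box.
apply/seteqP; split => [_ -> k|s st]; first by rewrite in_itv /= !lexx.
by apply/eq_from_tnth => k; have := st k; rewrite itvxx inE => /eqP.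
Qed.

Lemma punctured_cubeE : @punctured_cube R n =
  [set t | forall k, tnth t k \in `[0, 1[%R] `\ [tuple 0 | _ < n].
Proof.
apply/seteqP; split => [t [tc [i ti]]|t [tc t0]].
  split=> [k|]; first by rewrite in_itv; exact: tc.
  by move=> tE; move: ti; rewrite tE tnth_mktuple eqxx.
split=> [i|]; first by have := tc i; rewrite in_itv.
apply: contrapT => nex; apply: t0; apply/eq_from_tnth => k.
by rewrite tnth_mktuple; apply: contrapT => /eqP tk; apply: nex; exists k.
Qed.

Lemma measurable_punctured_cube : measurable (@punctured_cube R n).
Proof.
rewrite punctured_cubeE; apply: measurableD; last exact: measurable_tuple1.
exact: measurable_tuple_box.
Qed.

Lemma punctured_cube_sub : @punctured_cube R n `<=` @cube R n.
Proof. by move=> t [tc _] k; have /andP[-> /ltW] := tc k. Qed.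

Lemma measurable_hinge z : measurable_fun setT (hinge z).
Proof.
apply: measurable_prod => a _; apply: measurable_maxr => //.
by apply: measurable_funB => //; exact: (@measurable_tnth _ R n a).
Qed.

Lemma hinge_factor_itv (y s : R) : 0 <= y <= 1 -> 0 <= s <= 1 ->
  0 <= Num.max (y - s) 0 <= 1.
Proof.
move=> /andP[y0 y1] /andP[s0 s1].
by rewrite le_max lexx orbT ge_max ler01 andbT /=; lra.
Qed.

Lemma hinge_itv z t : (forall k, 0 <= z k <= 1) -> cube t ->
  0 <= hinge z t <= 1.
Proof.
move=> zc tc; have zt a := hinge_factor_itv (zc a) (tc a).
apply/andP; split; first by apply: prodr_ge0 => a _; case/andP: (zt a).
by apply: prodr_ile1 => a _; exact: zt.
Qed.

Lemma bounded_on_cube_hinge z : (forall k, 0 <= z k <= 1) ->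
  bounded_on_cube (hinge z).
Proof.
move=> zc; exists 1 => t tc; have /andP[h0 h1] := hinge_itv zc tc.
by rewrite ger0_norm.
Qed.

(** Factors are exchanged one at a time; each exchange costs at most its own difference, the other
    factors being in [0, 1]. *)
Lemma dist_prod_le (I : Type) (r : seq I) (a b : I -> R) :
  (forall i, 0 <= a i <= 1) -> (forall i, 0 <= b i <= 1) ->
  `|\prod_(i <- r) a i - \prod_(i <- r) b i| <= \sum_(i <- r) `|a i - b i|.
Proof.
move=> a01 b01; elim: r => [|i r IH]; first by rewrite !big_nil subrr normr0.
rewrite !big_cons; set A := \prod_(j <- r) a j; set B := \prod_(j <- r) b j.
have -> : a i * A - b i * B = (a i - b i) * A + b i * (A - B) by ring.
have A01 : `|A| <= 1.
  rewrite ger0_norm; first by apply: prodr_ile1 => j _; exact: a01.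
  by apply: prodr_ge0 => j _; case/andP: (a01 j).
have bi : `|b i| <= 1 by case/andP: (b01 i) => *; rewrite ger0_norm.
rewrite (le_trans (ler_normD _ _))// !normrM lerD//.
  by rewrite ler_piMr.
by apply: le_trans IH; rewrite ler_piMl.
Qed.

Lemma dist_max0_le (a b : R) : `|Num.max a 0 - Num.max b 0| <= `|a - b|.
Proof.
rewrite ler_norml; have := ler_norm (a - b); have := ler_norm (b - a).
rewrite [in X in X -> _]distrC.
by case: (leP a 0); case: (leP b 0) => *; apply/andP; split; lra.
Qed.

Lemma uniformly_continuous_hinge z : (forall k, 0 <= z k <= 1) ->
  uniformly_continuous_on_cube (hinge z).
Proof.
move=> zc e e0; have n0 : 0 < n.+1%:R :> R by rewrite ltr0n.
(* Dividing by [n.+1] rather than [n] covers dimension 0. *)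
exists (e / n.+1%:R) => [|s t sc tc st]; first by rewrite divr_gt0.
apply: le_trans (dist_prod_le _ _ _) _.
- by move=> a; exact: hinge_factor_itv.
- by move=> a; exact: hinge_factor_itv.
apply: (@le_trans _ _ (\sum_(a < n) e / n.+1%:R)).
  apply: ler_sum => a _; apply: le_trans (dist_max0_le _ _) _.
  by rewrite (_ : _ - _ = tnth t a - tnth s a) 1?distrC; [exact: st|ring].
rewrite sumr_const card_ord -(mulr_natr (e / _)) mulrAC ler_pdivrMr//.
by rewrite ler_pM2l// ler_nat.
Qed.

Variable mu : {finite_measure set (n.-tuple R) -> \bar R}.

Lemma integrable_bounded_on_cube (D : set (n.-tuple R)) h :
  measurable D -> D `<=` @cube R n -> measurable_fun setT h ->
  bounded_on_cube h -> mu.-integrable D (EFin \o h).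
Proof.
move=> mD Dc mh [C hC]; apply: measurable_bounded_integrable => //.
- by rewrite ltey_eq fin_num_measure.
- exact: measurable_funTS.
exists C; split; first exact: num_real.
by move=> M CM t Dt; exact: le_trans (hC t (Dc t Dt)) (ltW CM).
Qed.

(** A point of the cube outside the punctured cube is the origin or has a coordinate equal to 1,
    where [h] vanishes. Only the atom at the origin remains. *)
Lemma Rintegral_cube h : measurable_fun setT h -> bounded_on_cube h ->
    (forall t, cube t -> (exists k, tnth t k = 1) -> h t = 0) ->
  \int[mu]_(t in @cube R n) h t = \int[mu]_(t in @punctured_cube R n) h t +
    fine (mu [set [tuple 0 | _ < n]]) * h [tuple 0 | _ < n].
Proof.
move=> mh hb h1; set o := [tuple 0 | _ < n].
have oc : cube o by move=> k; rewrite tnth_mktuple lexx ler01.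
have mo := measurable_tuple1 o; have mp := measurable_punctured_cube.
have po : [disjoint @punctured_cube R n & [set o]].
  apply/disj_setPS => t [/=]; rewrite punctured_cubeE => -[_ to] tE.
  by apply: to; rewrite tE.
have sub : @punctured_cube R n `|` [set o] `<=` @cube R n.
  by move=> t [/punctured_cube_sub//|->].
have mu_ : measurable (@punctured_cube R n `|` [set o]) by exact: measurableU.
have -> : fine (mu [set o]) * h o = \int[mu]_(t in [set o]) h t.
  rewrite (@eq_Rintegral _ _ _ _ _ (cst (h o))); last by move=> t /[!inE] ->.
  by rewrite Rintegral_cst// mulrC.
rewrite -Rintegral_setU//; last exact: integrable_bounded_on_cube.
rewrite [LHS]Rintegral_mkcond [RHS]Rintegral_mkcond.
apply: eq_Rintegral => t _; rewrite /patch; case: ifPn; case: ifPn => //.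
  move=> tn; rewrite inE => tc; apply: h1 => //.
  apply: contrapT => nex; move/negP: tn; apply; rewrite inE.
  have [to|to] := eqVneq t o; first by right.
  left; rewrite punctured_cubeE; split; last exact/eqP.
  move=> k; rewrite in_itv /=; have /andP[-> t1] := tc k.
  by rewrite lt_neqAle t1 andbT; apply/eqP => tk; apply: nex; exists k.
by rewrite inE => /sub tc /negP; rewrite inE.
Qed.

End cube_integrals.

(** * Pushforward of a finite measure *)

Definition image_measure d d' (T : measurableType d) (T' : measurableType d')
    (R : realType) (m : {finite_measure set T -> \bar R})
    (f : {mfun T >-> T'}) : set T' -> \bar R :=
  pushforward m f.

Section image_measure.
Context d d' {T : measurableType d} {T' : measurableType d'} {R : realType}.
Variables (m : {finite_measure set T -> \bar R}) (f : {mfun T >-> T'}).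

Let image0 : image_measure m f set0 = 0%E.
Proof. exact: measure0. Qed.

Let image_ge0 A : (0 <= image_measure m f A)%E.
Proof. exact: measure_ge0. Qed.

Let image_sigma_additive : semi_sigma_additive (image_measure m f).
Proof. exact: measure_semi_sigma_additive. Qed.

HB.instance Definition _ := isMeasure.Build _ _ _ (image_measure m f)
  image0 image_ge0 image_sigma_additive.

Let image_fin : fin_num_fun (image_measure m f).
Proof.
move=> A mA; apply: (fin_num_measure m).
by rewrite -[X in measurable X]setTI; exact: measurable_funPT.
Qed.

HB.instance Definition _ := Measure_isFinite.Build _ _ _ (image_measure m f)
  image_fin.

End image_measure.

(** * Representation of positive functionals by measures *)

(** The cube is cut successively by an enumeration of the rational half-spaces
    [q <= x_k]. The cell with code [a] has mass [mass a], and nested intervals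
    of these lengths split [0, mass [::][ accordingly. Sending a real number to
    the point of the cube lying in all the (closed) cells selected by its nested
    intervals pushes Lebesgue measure forward to the representing measure. *)
Section cell_tree.
Context {R : realType} {n : nat}.
Implicit Types (x : n.-tuple R) (a : seq bool) (u : R) (N l : nat).

Definition halfspace l x : bool :=
  if (unpickle l : option ('I_n * rat)) is Some (k, q)
  then ratr q <= tnth x k else false.

(** The most recent bit comes first, in codes and in addresses alike. *)
Fixpoint code x N : seq bool :=
  if N is N'.+1 then halfspace N' x :: code x N' else [::].

Lemma code_halfspace x y N l : code x N = code y N -> (l < N)%N ->
  halfspace l x = halfspace l y.
Proof.
elim: N => // N IH [hN xy]; rewrite ltnS leq_eqVlt => /predU1P[->//|].
exact: IH.
Qed.

(** Half-spaces with thresholds i / D, where D > 1 / e, all occur before some [N] and bracket every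
    coordinate within [e], uniformly in the point. *)
Lemma code_bracket (e : R) : 0 < e -> exists N, forall x k, cube x ->
  exists q1 q2 : rat, [/\ (pickle (k, q1) < N)%N, (pickle (k, q2) < N)%N,
    ratr q1 <= tnth x k, tnth x k < ratr q2 & ratr q2 - ratr q1 <= e].
Proof.
move=> e0; pose D := (Num.truncn e^-1).+1.
have De : (D%:R : R)^-1 <= e.
  by rewrite -[leRHS]invrK lef_pV2 ?posrE ?invr_gt0// ltW// truncnS_gt.
have D0 : (0 : R) < D%:R by rewrite ltr0n.
pose node (i : nat) : rat := i%:R / D%:R.
have nodeE i : ratr (node i) = i%:R / D%:R :> R.
  by rewrite /node fmorph_div /= !ratr_nat.
(* Thresholds go up to (D + 1) / D, so that a coordinate equal to 1 also has a strict upper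
   bracket. *)
exists (\max_(p : 'I_n * 'I_D.+2) (pickle (p.1, node p.2))).+1 => x k xc.
have nodeN (i : nat) : (i < D.+2)%N -> (pickle (k, node i) <
    (\max_(p : 'I_n * 'I_D.+2) (pickle (p.1, node p.2))).+1)%N.
  by move=> iD; rewrite ltnS (leq_bigmax (k, Ordinal iD)).
have /andP[x0 x1] := xc k.
have := truncn_itv (mulr_ge0 x0 (ltW D0)).
set i := Num.truncn _ => /andP[i1 i2].
have iD : (i <= D)%N by rewrite -(ler_nat R) (le_trans i1)// ler_piMl// ltW.
exists (node i), (node i.+1); rewrite !nodeE; split.
- by rewrite nodeN// ltnS ltnW.
- by rewrite nodeN.
- by rewrite ler_pdivrMr.
- by rewrite ltr_pdivlMr.
- by rewrite -natr1 mulrDl mul1r addrAC subrr add0r.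
Qed.

Variable L : (n.-tuple R -> R) -> R.

Definition mass a : R := L (fun x => (code x (size a) == a)%:R).

(** The cell of code [a] receives the interval [left_end a, left_end a + mass a[, whose left part
    goes to the [false] child and right part to the [true] child. *)
Fixpoint left_end a : R :=
  if a is b :: a' then left_end a' + (if b then mass (false :: a') else 0)
  else 0.

Fixpoint address u N : seq bool :=
  if N is N'.+1 then
    let a := address u N' in (left_end a + mass (false :: a) <= u) :: a
  else [::].

Lemma size_code x N : size (code x N) = N.
Proof. by elim: N => //= N ->. Qed.

Lemma size_address u N : size (address u N) = N.
Proof. by elim: N => //= N ->. Qed.

Lemma code_address_le x u N l : (l <= N)%N ->
  code x N = address u N -> code x l = address u l.
Proof.
elim: N => [|N IH]; first by rewrite leqn0 => /eqP ->.
by rewrite leq_eqVlt => /predU1P[->//|lN] [_ /IH]; apply.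
Qed.

Hypothesis Lpos : positive_functional L.

Lemma mass_ge0 a : 0 <= mass a.
Proof. by apply: (pf_ge0 Lpos) => //; exact: bounded_on_cube_bool. Qed.

Lemma mass_split a : mass a = mass (false :: a) + mass (true :: a).
Proof.
rewrite -[mass (false :: a)]mul1r /mass -(pf_linear Lpos);
  try exact: bounded_on_cube_bool.
congr L; apply/funext => x /=; rewrite !eqseq_cons.
by case: (halfspace _ x); rewrite /= ?mulr0 ?add0r ?mul1r ?addr0.
Qed.

Lemma left_end_ge0 a : 0 <= left_end a.
Proof.
by elim: a => [//|b a IH] /=; rewrite addr_ge0//; case: b; rewrite ?mass_ge0.
Qed.

Lemma right_end_le a : left_end a + mass a <= mass [::].
Proof.
elim: a => [|b a IH] /=; first by rewrite add0r.
apply: le_trans IH; rewrite (mass_split a).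
by have := mass_ge0 (true :: a); case: b => /=; lra.
Qed.

(** By [mass_split], the children's intervals cut that of their parent at the very point with which
    [address] compares [u]. *)
Lemma address_eqE u a : 0 <= u < mass [::] ->
  (address u (size a) == a) = (left_end a <= u < left_end a + mass a).
Proof.
move=> uM; elim: a => [|b a IH] /=; first by rewrite add0r uM eqxx.
rewrite eqseq_cons; have [eqa|neqa] := eqVneq (address u (size a)) a.
  move: IH; rewrite eqa eqxx andbT => /esym/andP[ua1 ua2].
  move: ua2; rewrite (mass_split a).
  rewrite addrA; case: b => u2 /=; first by rewrite eqb_id u2 andbT.
  by rewrite eqbF_neg -ltNge addr0 ua1.
rewrite andbF; move: IH; rewrite (negbTE neqa) => IH.
apply/esym/negbTE/negP => /andP[u1 u2].
suff: left_end a <= u < left_end a + mass a by rewrite -IH.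
rewrite (mass_split a); have := mass_ge0 (true :: a).
have := mass_ge0 (false :: a).
by case: b u1 u2 => /= *; apply/andP; split; lra.
Qed.

Lemma mass_gt0_code a : 0 < mass a -> exists2 x, cube x & code x (size a) = a.
Proof.
move=> a0; apply: contrapT => noex; suff: mass a = 0 by move=> a0'; lra.
rewrite -(pf_zero Lpos); apply: (pf_eq Lpos) => [||x xc].
- exact: bounded_on_cube_bool.
- exact: bounded_on_cube_cst.
- by case: eqP => // xa; case: noex; exists x.
Qed.

(** The interval of the address contains [u], so its cell has positive mass, and a cell missing the
    cube would have mass 0. *)
Lemma address_code u N : 0 <= u < mass [::] ->
  exists2 x, cube x & code x N = address u N.
Proof.
move=> uM; have := @address_eqE u (address u N) uM; rewrite size_address eqxx.
move=> /esym/andP[u1 u2].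
have m0 : 0 < mass (address u N) by lra.
have [x xc xE] := mass_gt0_code m0.
by exists x => //; rewrite -xE size_address.
Qed.

(** Makes the parametrization total: reals off the base interval are treated as 0, which lies in it
    once the total mass is positive. *)
Definition clamp u : R := if 0 <= u < mass [::] then u else 0.

(** The supremum over [l] is a Dedekind cut: it runs over the thresholds of the half-spaces in
    direction [k] selected by the address of [u]. The cap at 1 makes the family bounded. *)
Definition limit_term (k : 'I_n) u l : R :=
  if (unpickle l : option ('I_n * rat)) is Some (k', q)
  then if (k' == k) && head false (address (clamp u) l.+1)
       then Num.min (ratr q) 1 else 0
  else 0.

(** Written with [sups] so that measurability of countable suprema applies. *)
Definition limit_coord (k : 'I_n) u : R := sups (limit_term k u) 0.

Definition limit_point u : n.-tuple R := [tuple limit_coord k u | k < n].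

Lemma limit_term_le1 k u l : limit_term k u l <= 1.
Proof.
rewrite /limit_term; case: unpickle => [[k' q]|//].
by case: ifP => _ //; rewrite ge_min lexx orbT.
Qed.

Lemma limit_term_ub k u : has_ubound (range (limit_term k u)).
Proof. by exists 1 => _ [l _ <-]; exact: limit_term_le1. Qed.

Lemma limit_coordE k u : limit_coord k u = sup (range (limit_term k u)).
Proof.
rewrite /limit_coord /sups /= /sdrop; congr sup.
by apply/seteqP; split => _ [l _ <-]; exists l.
Qed.

Lemma limit_term_le_coord k u l : limit_term k u l <= limit_coord k u.
Proof.
by rewrite limit_coordE; apply: ub_le_sup; [exact: limit_term_ub|exists l].
Qed.

Lemma limit_coord_le k u c : (forall l, limit_term k u l <= c) ->
  limit_coord k u <= c.
Proof.
move=> uc; rewrite limit_coordE; apply: ge_sup => [|_ [l _ <-]//].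
by exists (limit_term k u 0); exists 0.
Qed.

Hypothesis mass_gt0 : 0 < mass [::].

Lemma clampP u : 0 <= clamp u < mass [::].
Proof. by rewrite /clamp; case: ifP => // _; rewrite lexx. Qed.

Lemma le_limit_coord x u N (k : 'I_n) (q : rat) : cube x ->
    code x N = address (clamp u) N -> (pickle (k, q) < N)%N ->
  ratr q <= tnth x k -> ratr q <= limit_coord k u.
Proof.
move=> xc xE lN qx; apply: le_trans (limit_term_le_coord _ _ (pickle (k, q))).
rewrite /limit_term -(code_address_le lN xE) pickleK eqxx /=.
rewrite /halfspace pickleK qx le_min lexx /=.
by rewrite (le_trans qx)//; case/andP: (xc k).
Qed.

(** If the address of [u] selects a threshold q', however late, some point [y] of the cube follows
    this address past both levels. It shares the first [N] bits of [x], so q' <= y_k < q. *)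
Lemma limit_coord_le_lt x u N (k : 'I_n) (q : rat) : cube x ->
    code x N = address (clamp u) N -> (pickle (k, q) < N)%N ->
  tnth x k < ratr q -> limit_coord k u <= ratr q.
Proof.
move=> xc xE lN xq; apply: limit_coord_le => l; rewrite /limit_term.
have q0 : (0 : R) <= ratr q by case/andP: (xc k) => x0 _; lra.
case lE: unpickle => [[k' q']|//]; case: ifPn => // /andP[/eqP k'k hl].
have [y yc yE] := address_code (maxn N l.+1) (clampP u).
have ly : head false (code y l.+1) by rewrite (code_address_le _ yE)// leq_maxr.
have Ny : code y N = code x N by rewrite xE (code_address_le _ yE)// leq_maxl.
have qy : ~~ halfspace (pickle (k, q)) y.
  have : halfspace (pickle (k, q)) y = halfspace (pickle (k, q)) x.
    have [] := code_address_le lN (etrans Ny xE).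
    by have [->] := code_address_le lN xE.
  by move=> ->; rewrite /halfspace pickleK -ltNge.
move: ly qy; rewrite /= /halfspace lE pickleK k'k -ltNge => q'y yq.
by rewrite ge_min (ltW (le_lt_trans q'y yq)).
Qed.

Lemma limit_point_cube u : cube (limit_point u).
Proof.
move=> k; rewrite tnth_mktuple.
(* The half-space of threshold 0 contains the cube and yields the lower bound. *)
have [x xc xE] := address_code (pickle (k, 0 : rat)).+1 (clampP u).
rewrite -[0](rmorph0 (ratr : rat -> R)).
rewrite (le_limit_coord xc xE)//=; last by rewrite rmorph0; case/andP: (xc k).
by apply: limit_coord_le => l; exact: limit_term_le1.
Qed.

(** Two thresholds bracketing a coordinate of [x] within [e] also bracket that of any point with the
    same [N] bits, and that of the limit point of any [u] whose address starts with them. *)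
Lemma limit_point_close (e : R) : 0 < e -> exists N,
  (forall x y, cube x -> cube y -> code x N = code y N ->
    forall k, `|tnth x k - tnth y k| <= e) /\
  (forall x u, cube x -> code x N = address (clamp u) N ->
    forall k, `|tnth (limit_point u) k - tnth x k| <= e).
Proof.
move=> e0; have [N bracket] := code_bracket e0; exists N.
split=> [x y xc yc xy k|x u xc xE k];
  have [q1 [q2 [N1 N2 xq1 xq2 q12]]] := bracket x k xc.
  have := code_halfspace xy N1; rewrite /halfspace pickleK xq1 => /esym yq1.
  have := code_halfspace xy N2; rewrite /halfspace pickleK leNgt xq2/= leNgt.
  by move=> /esym/negbFE yq2; rewrite ler_norml; apply/andP; split; lra.
have := le_limit_coord xc xE N1 xq1; have := limit_coord_le_lt xc xE N2 xq2.
by rewrite tnth_mktuple ler_norml => *; apply/andP; split; lra.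
Qed.

Let base_itv : set (measurableTypeR R) := `[0, mass [::][%classic.

Let measurable_base : measurable base_itv.
Proof. exact: measurable_itv. Qed.

Let base_lty : (lebesgue_measure base_itv < +oo)%E.
Proof. by rewrite lebesgue_measure_itv /=; case: ifP => _; rewrite ?ltry. Qed.

Let base : {finite_measure set (measurableTypeR R) -> \bar R} :=
  mfrestr measurable_base base_lty.

Let cell a : set (measurableTypeR R) :=
  [set u | address (clamp u) (size a) = a].

Lemma cell_base a :
  cell a `&` base_itv = `[left_end a, left_end a + mass a[%classic.
Proof.
have a0 := left_end_ge0 a; have aM := right_end_le a.
apply/seteqP; split => [u [/= /eqP ua]|u /=].
  by rewrite /base_itv /= in_itv /= => uM; move: ua;
     rewrite /clamp uM address_eqE// in_itv.
rewrite in_itv /= => ua.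
have uM : 0 <= u < mass [::] by case/andP: ua => u1 u2; apply/andP; split; lra.
split; last by rewrite /base_itv /= in_itv.
by apply/eqP; rewrite /clamp uM address_eqE.
Qed.

Lemma measurable_cell a : measurable (cell a).
Proof.
rewrite -[cell a](setUIDK _ base_itv) cell_base.
apply: measurableU; first exact: measurable_itv.
(* Off the base interval [clamp] is constantly 0, so the cell is all or nothing there. *)
have -> : cell a `\` base_itv =
    (if address 0 (size a) == a then setT else set0) `\` base_itv.
  apply/seteqP; split => u /= [p nu]; split => //; move: p;
    have uM : (0 <= u < mass [::]) = false by
      apply/negbTE/negP => uM; apply: nu; rewrite /base_itv /= in_itv.
  - by rewrite /cell /= /clamp uM => ->; rewrite eqxx.
  - by rewrite /cell /= /clamp uM; case: eqP.
by apply: measurableD => //; case: ifP.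
Qed.

Lemma base_cell a : base (cell a) = (mass a)%:E.
Proof.
rewrite /base /= /mfrestr /mrestr cell_base lebesgue_measure_itv /= lte_fin.
rewrite -EFinB addrAC subrr add0r; case: ltP => //.
by have := mass_ge0 a => a0 a1; congr EFin; lra.
Qed.

Definition step (g : seq bool -> R) N u := g (address (clamp u) N).

Lemma stepE g N u :
  step g N u = \sum_(a : N.-tuple bool) g a * \1_(cell a) u.
Proof.
have sa : size (address (clamp u) N) == N by rewrite size_address.
rewrite (bigD1 (Tuple sa)) //= big1 ?addr0 => [|a ane].
  by rewrite indicE mem_set ?mulr1// /cell /= size_address.
rewrite indicE memNset ?mulr0// /cell /= size_tuple => ua.
by case/negP: ane; apply/eqP/val_inj.
Qed.

Lemma measurable_step g N : measurable_fun setT (step g N).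
Proof.
rewrite (_ : step g N = fun u => \sum_(a : N.-tuple bool) g a * \1_(cell a) u);
  last by apply/funext => u; exact: stepE.
apply: measurable_sum => a; apply: measurable_funM => //.
by apply: measurable_indic; exact: measurable_cell.
Qed.

Lemma integrable_bounded (g : measurableTypeR R -> R) C :
  measurable_fun setT g -> (forall u, `|g u| <= C) ->
  base.-integrable setT (EFin \o g).
Proof.
move=> mg gC; apply: measurable_bounded_integrable => //.
  by apply: fin_num_fun_lty; exact: fin_num_measure.
exists C; split; first exact: num_real.
by move=> D CD u _; exact: le_trans (gC u) (ltW CD).
Qed.

Lemma integral_step g N :
  \int[base]_u step g N u = \sum_(a : N.-tuple bool) g a * mass a.
Proof.
rewrite /Rintegral; under eq_integral do rewrite stepE -sumEFin.
have mc (a : N.-tuple bool) := measurable_cell a.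
have ic (a : N.-tuple bool) : base.-integrable setT (EFin \o \1_(cell a)).
  apply: (@integrable_bounded _ 1) => [|u]; first exact: measurable_indic.
  by rewrite indicE; case: (_ \in _); rewrite ?normr1 ?normr0.
rewrite integral_sum//=; last first.
  by move=> a; under eq_fun do rewrite EFinM; exact: integrableZl (ic a).
have E (a : N.-tuple bool) :
    (\int[base]_u (g a * \1_(cell a) u)%:E = (g a * mass a)%:E)%E.
  under eq_integral do rewrite EFinM.
  rewrite (integralZl measurableT (ic a)) integral_indic// setIT EFinM.
  by congr (_ * _)%E; exact: base_cell.
by under eq_bigr do rewrite E; rewrite sumEFin.
Qed.

(** Each term of the supremum depends only on an address of fixed length, hence is a step
    function. *)
Lemma measurable_limit_point :
  measurable_fun setT (limit_point : measurableTypeR R -> n.-tuple R).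
Proof.
apply/measurable_fun_tnthP => k.
rewrite (_ : _ \o _ = limit_coord k); last first.
  by apply/funext => u; rewrite /= tnth_mktuple.
apply: measurable_fun_sups => [u _|l]; first exact: limit_term_ub.
rewrite /limit_term; case: unpickle => [[k' q]|]; last exact: measurable_cst.
case: (k' == k) => /=; last exact: measurable_cst.
exact: (measurable_step
  (fun a => if head false a then Num.min (ratr q) 1 else 0) l.+1).
Qed.

HB.instance Definition _ := isMeasurableFun.Build _ _ _ _
  (limit_point : measurableTypeR R -> n.-tuple R) measurable_limit_point.

Definition representing_measure : {finite_measure set (n.-tuple R) -> \bar R} :=
  image_measure base
    (limit_point : {mfun measurableTypeR R >-> n.-tuple R}).

Lemma base_setT : base setT = (mass [::])%:E.
Proof.
rewrite -base_cell; congr (base _).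
by apply/seteqP; split => // u _; rewrite /cell.
Qed.

(** Both sides are compared with the same Riemann sum, which weights a sample value of [h] in each
    cell by the mass of the cell. Uniform continuity makes each error at most [e / 2]. *)
Lemma representing_measureE h :
    measurable_fun setT h -> bounded_on_cube h ->
    uniformly_continuous_on_cube h ->
  L h = \int[representing_measure]_(x in @cube R n) h x.
Proof.
move=> mh [C hC] uh.
have preT : limit_point @^-1` (@cube R n) = setT.
  by apply/seteqP; split => // u _; exact: limit_point_cube.
have mhl : measurable_fun setT (h \o limit_point : measurableTypeR R -> R).
  by apply: measurableT_comp => //; exact: measurable_limit_point.
have ihl : base.-integrable setT (EFin \o (h \o limit_point)).
  by apply: (@integrable_bounded _ C) => // u; apply/hC/limit_point_cube.
rewrite /Rintegral /representing_measure /image_measure.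
have mhE : measurable_fun setT (EFin \o h) by exact/measurable_EFinP.
have ihE : base.-integrable (limit_point @^-1` (@cube R n))
  ((EFin \o h) \o limit_point) by rewrite preT.
rewrite (integral_pushforward measurable_limit_point mhE ihE
  (@measurable_cube R n)).
rewrite preT -[fine _]/(\int[base]_u (h (limit_point u))).
apply/eqP; rewrite -subr_eq0 -normr_le0; apply/ler_addgt0Pl => e e0.
(* This tolerance times the total mass is [e / 2]. *)
have e1 : 0 < e / (2 * mass [::]) by rewrite divr_gt0// mulr_gt0.
rewrite addr0; have [d d0 hd] := uh _ e1.
have [N [close_code close_limit]] := limit_point_close d0.
(* A sample point in each cell that meets the cube; the origin is the default for other codes. *)
pose pt a := xget [tuple 0 | _ < n]
  [set x : n.-tuple R | cube x /\ code x N = a].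
have ptP x : cube x ->
    cube (pt (code x N)) /\ code (pt (code x N)) N = code x N.
  by move=> xc; apply: (@xgetPex _ _ [set y | cube y /\ code y N = code x N]);
     exists x.
pose g a := h (pt a).
set S := \sum_(a : N.-tuple bool) g a * mass a.
have LS : `|L h - S| <= e / 2.
  have -> : S = L (fun x => \sum_(a : N.-tuple bool) g a * (code x N == a)%:R).
    rewrite (pf_sum Lpos) => [|a]; last exact: bounded_on_cube_bool.
    by apply: eq_bigr => a _; rewrite /mass size_tuple.
  rewrite -(pf_sub Lpos); [|by exists C|].
    apply: le_trans (pf_norm_le Lpos (C := e / (2 * mass [::])) _) _.
      move=> x xc; have sx : size (code x N) == N by rewrite size_code.
      rewrite (bigD1 (Tuple sx)) //= eqxx mulr1 big1 ?addr0; last first.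
        move=> a ane; case: eqP => [xa|]; rewrite ?mulr0//.
        by case/negP: ane; apply/eqP/val_inj.
      have [xc' xE] := ptP _ xc.
      by apply: hd => // k; apply: close_code.
    have -> : L (fun=> 1) = mass [::] by congr L; apply/funext.
    by rewrite invfM mulrA divfK// gt_eqF.
  by apply: bounded_on_cube_sum => a; exact: bounded_on_cube_bool.
have IS : `|\int[base]_u h (limit_point u) - S| <= e / 2.
  have ig : base.-integrable setT (EFin \o step g N).
    apply: (@integrable_bounded _ C) => [|u]; first exact: measurable_step.
    have [x xc xE] := address_code N (clampP u).
    by rewrite /step /g -xE; apply: hC; have [] := ptP _ xc.
  rewrite /S -integral_step -RintegralB//.
  have idiff : base.-integrable setT
      (EFin \o (fun u => h (limit_point u) - step g N u)).
    rewrite (_ : _ \o _ =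
      (fun u => (h (limit_point u))%:E - (step g N u)%:E)%E)//.
    exact: integrableB.
  apply: le_trans (le_normr_Rintegral measurableT idiff) _.
  apply: (@le_trans _ _ (\int[base]_u (e / (2 * mass [::])))).
    apply: le_Rintegral => //.
    - exact: integrable_norm.
    - by apply: (@integrable_bounded _ `|e / (2 * mass [::])|) => // u.
    - move=> u _; have [x xc xE] := address_code N (clampP u).
      have [xc' xE'] := ptP _ xc.
      rewrite /step /g -xE; apply: hd => //; first exact: limit_point_cube.
      by move=> k; apply: close_limit => //; rewrite xE'.
  have -> : \int[base]_u (e / (2 * mass [::])) =
      e / (2 * mass [::]) * mass [::].
    by rewrite Rintegral_cst//; congr (_ * _); exact: (congr1 fine base_setT).
  by rewrite invfM mulrA divfK// gt_eqF.
have -> : L h - \int[base]_u h (limit_point u) =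
  (L h - S) - (\int[base]_u h (limit_point u) - S) by ring.
by rewrite (le_trans (ler_normB _ _))// [leRHS](splitr e) lerD.
Qed.

End cell_tree.

(** If the total mass is 0, then [L] vanishes on bounded functions and the zero measure represents
    it; otherwise the cell construction applies. *)
Lemma pf_representation (R : realType) n (L : (n.-tuple R -> R) -> R) :
  positive_functional L ->
  exists mu : {finite_measure set (n.-tuple R) -> \bar R}, forall h,
    measurable_fun setT h -> bounded_on_cube h ->
    uniformly_continuous_on_cube h ->
    L h = \int[mu]_(x in @cube R n) h x.
Proof.
move=> Lpos; have := mass_ge0 Lpos [::].
rewrite le_eqVlt => /predU1P[M0|M0]; last first.
  by exists (representing_measure Lpos) => h *; exact: representing_measureE.
exists mzero => h _ [C hC] _.
rewrite /Rintegral integral_measure_zero /=.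
apply/eqP; rewrite -normr_le0 (le_trans (pf_norm_le Lpos hC))//.
have -> : L (fun=> 1) = mass L [::] by congr L; apply/funext.
by rewrite -M0 mulr0.
Qed.

(** * Interpolation on grids *)

Section tensor.
Context {R : comPzRingType} {d : nat}.

(** Distributivity with a range of summation depending on the factor, as the number of nodes does in
    [divided_difference]. *)
Lemma prod_sum_dffun (T : 'I_d -> finType) (F : forall k, T k -> R) :
  \prod_k \sum_j F k j = \sum_(i : {dffun forall k, T k}) \prod_k F k (i k).
Proof.
rewrite (reindex (@dffun_of_fprod _ T)); last first.
  exact/onW_bij/dffun_of_fprod_bij.
pose F' k := [ffun j => F k j].
transitivity (\sum_(t : fprod T) \prod_(k in 'I_d) F' k (t k)); last first.
  by apply: eq_bigr => t _; apply: eq_bigr => k _; rewrite /F' !ffunE.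
rewrite big_fprod -(bigA_distr_big_dep _ (fun k => untag 0 (F' k))).
apply: eq_bigr => k _; rewrite -(big_tag (fun k => F' k)).
by apply: eq_bigr => j _; rewrite ffunE.
Qed.

(** The tensor product of the one-variable functionals with weights [c k], applied to [F]. It
    reduces the multivariate identities to one variable. *)
Definition tensor m (c : 'I_d -> 'I_m -> R)
    (F : {ffun 'I_d -> 'I_m} -> R) : R :=
  \sum_(l : {ffun 'I_d -> 'I_m}) (\prod_k c k (l k)) * F l.

Lemma eq_tensor m (c c' : 'I_d -> 'I_m -> R) F : (forall k, c k =1 c' k) ->
  tensor c F = tensor c' F.
Proof. by move=> cc'; apply: eq_bigr => l _; under eq_bigr do rewrite cc'. Qed.

Lemma tensor_delta m (w : 'I_d -> R) (j : 'I_d -> 'I_m) F :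
  tensor (fun k l => w k * (l == j k)%:R) F = (\prod_k w k) * F [ffun k => j k].
Proof.
rewrite /tensor (bigD1 [ffun k => j k]) //= [X in _ + X]big1 ?addr0.
  by congr (_ * _); apply: eq_bigr => k _; rewrite ffunE eqxx mulr1.
move=> l lj; have [k kj] : exists k, l k != j k.
  apply/existsP; rewrite -negb_forall; apply: contraNN lj => /forallP lj.
  by apply/eqP/ffunP => k; rewrite ffunE; apply/eqP.
by rewrite (bigD1 k)//= (negbTE kj) mulr0 !mul0r.
Qed.

Lemma tensorZ m (w : 'I_d -> R) (c : 'I_d -> 'I_m -> R) F :
  tensor (fun k l => w k * c k l) F = (\prod_k w k) * tensor c F.
Proof.
by rewrite mulr_sumr; apply: eq_bigr => l _; rewrite big_split mulrA.
Qed.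

Lemma tensor_family m (J : finType) (P : 'I_d -> pred J)
    (c : 'I_d -> J -> 'I_m -> R) F :
  tensor (fun k l => \sum_(j | P k j) c k j l) F =
  \sum_(i in family P) tensor (fun k => c k (i k)) F.
Proof.
rewrite exchange_big /=; apply: eq_bigr => l _.
by rewrite (bigA_distr_big_dep P (fun k j => c k j (l k))) mulr_suml.
Qed.

Lemma tensor_dffun m (T : 'I_d -> finType) (e : forall k, T k -> R)
    (s : forall k, T k -> 'I_m) F :
  tensor (fun k l => \sum_j e k j * (l == s k j)%:R) F =
  \sum_(i : {dffun forall k, T k})
    (\prod_k e k (i k)) * F [ffun k => s k (i k)].
Proof.
under [RHS]eq_bigr do rewrite -tensor_delta.
rewrite exchange_big /=; apply: eq_bigr => l _.
by rewrite prod_sum_dffun mulr_suml.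
Qed.

Lemma tensor_set m (c c' : 'I_d -> 'I_m -> R) F :
  tensor (fun k l => c k l + c' k l) F =
  \sum_(Q : {set 'I_d}) tensor (fun k => if k \in Q then c k else c' k) F.
Proof.
rewrite exchange_big /=; apply: eq_bigr => l _.
rewrite (bigA_distr _ _ (fun k => c k (l k)) (fun k => c' k (l k))) mulr_suml.
by apply: eq_bigr => Q _; congr (_ * _); apply: eq_bigr => k _; case: ifP.
Qed.

(** Expanding a product of first differences over [S] gives the alternating sums of
    [quotient_at_zero] and [quotient_at_one]. *)
Lemma tensor_difference m (S : {set 'I_d}) (a b z : 'I_m) r F :
  tensor (fun k l => if k \in S then r * ((l == b)%:R - (l == a)%:R)
                     else (l == z)%:R) F =
  r ^+ #|S| * \sum_(Q : {set 'I_d} | Q \subset S) (-1) ^+ (#|S| - #|Q|) *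
    F [ffun k => if k \in Q then b else if k \in S then a else z].
Proof.
(* [c] evaluates at [b] and [c'] at [a] or [z]; the weight 0 of [c] off [S] leaves only subsets of
   [S]. *)
pose c k (l : 'I_m) : R := (if k \in S then r else 0) * (l == b)%:R.
pose c' k (l : 'I_m) : R :=
  (if k \in S then - r else 1) * (l == if k \in S then a else z)%:R.
rewrite (eq_tensor (c' := fun k l => c k l + c' k l)); last first.
  by move=> k l; rewrite /c /c'; case: ifP => _; ring.
rewrite tensor_set mulr_sumr [RHS]big_mkcond /=; apply: eq_bigr => Q _.
pose w k : R := if k \in Q then if k \in S then r else 0
                else if k \in S then - r else 1.
rewrite (eq_tensor (c' := fun k l => w k *
    (l == if k \in Q then b else if k \in S then a else z)%:R)); last first.
  by move=> k l; rewrite /w /c /c'; case: ifP.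
rewrite tensor_delta; case: ifPn => [QS|/fintype.subsetPn[k kQ kS]]; last first.
  by rewrite (bigD1 k)//= /w kQ (negbTE kS) !mul0r.
rewrite mulrA; congr (_ * _).
transitivity ((\prod_(k in S) r) * \prod_(k in S :\: Q) (-1 : R)).
  rewrite [X in X * _]big_mkcond [X in _ * X]big_mkcond -big_split /=.
  apply: eq_bigr => k _; rewrite /w inE; have := fintype.subsetP QS k.
  by case: (k \in Q) => [/(_ isT) ->|_] /=; case: (k \in S) => /=; ring.
rewrite !prodr_const; congr (_ * _ ^+ _).
by rewrite cardsD (finset.setIidPr QS).
Qed.

End tensor.

(** * Grids and piecewise linear interpolation in one variable *)

Record grid (R : realType) := Grid {
  grid_size : nat;
  node : nat -> R;
  grid_size_gt0 : (0 < grid_size)%N;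
  node0 : node 0 = 0;
  node_size : node grid_size = 1;
  node_lt : forall i j, (i < j <= grid_size)%N -> node i < node j }.

Section grid.
Context {R : realType} (G : grid R).
Local Notation m := (grid_size G).
Local Notation x := (node G).

Lemma node_le i j : (i <= j <= m)%N -> x i <= x j.
Proof.
case/andP; rewrite leq_eqVlt => /predU1P[->//|ij] jm.
by rewrite ltW// node_lt// ij.
Qed.

Lemma node_itv i : (i <= m)%N -> 0 <= x i <= 1.
Proof.
by move=> im; rewrite -{1}(node0 G) -(node_size G) !node_le//= im leqnn.
Qed.

(** The slope on the [i]-th mesh interval as a functional on node values, given by its weight at
    each node [l]. *)
Definition slope i l : R :=
  ((l == i.+1)%:R - (l == i)%:R) / (x i.+1 - x i).

(** The functional, on the values at the nodes, giving the coefficient of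
    [hat i] below in the piecewise linear interpolation. *)
Definition coef i l : R :=
  match i with
  | 0 => (l == 0)%:R
  | 1 => slope 0 l
  | i'.+2 => slope i'.+1 l - slope i' l
  end.

(** The index is shifted: [hat i.+1] has its kink at node [i], so [hat 1] is the identity on
    [0, 1]. *)
Definition hat i y : R := if i is i'.+1 then Num.max (y - x i') 0 else 1.

Lemma sum_coef j l : \sum_(i < j.+1) coef i.+1 l = slope j l.
Proof.
elim: j => [|j IH]; first by rewrite big_ord1.
by rewrite big_ord_recr IH /= addrC subrK.
Qed.

Lemma hat_succ i j : (i <= m)%N -> (j < m)%N ->
  hat i.+1 (x j.+1) - hat i.+1 (x j) = (x j.+1 - x j) * (i <= j)%:R.
Proof.
move=> im jm /=; case: leqP => ij /=.
  have h1 : x i <= x j by rewrite node_le// ij ltnW.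
  have h2 : x j <= x j.+1 by rewrite node_le// leqnSn.
  by rewrite !max_l ?subr_ge0 ?(le_trans h1 h2)//; ring.
have h1 : x j.+1 <= x i by rewrite node_le// ij.
have h2 : x j <= x j.+1 by rewrite node_le// leqnSn.
by rewrite !max_r ?subr_le0 ?(le_trans h2 h1)// subrr mulr0.
Qed.

(** From node j to node j + 1 the sum grows by the mesh length times [slope j]: [hat i.+1] has slope
    1 there exactly when i <= j, and these coefficients telescope. *)
Lemma hat_interpolation j l : (j <= m)%N ->
  \sum_(i < m.+1) coef i l * hat i (x j) = (l == j)%:R.
Proof.
have -> : \sum_(i < m.+1) coef i l * hat i (x j) =
    (l == 0)%:R + \sum_(i < m) coef i.+1 l * hat i.+1 (x j).
  by rewrite big_ord_recl mulr1.
elim: j => [|j IH] jm.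
  rewrite big1 ?addr0// => i _; rewrite /hat max_r ?mulr0// subr_le0.
  by rewrite node_le//= ltnW.
rewrite -[LHS](subrK ((l == 0)%:R +
  \sum_(i < m) coef i.+1 l * hat i.+1 (x j))) [X in _ + X]IH 1?ltnW//.
rewrite opprD addrACA subrr add0r -sumrB.
under eq_bigr => i _ do rewrite -mulrBr (hat_succ (ltnW (ltn_ord i)) jm)
  mulrCA mulr_natr mulrb.
rewrite -mulr_sumr.
rewrite -big_mkcond /= -(big_ord_widen_cond m xpredT (fun i => coef i.+1 l) jm).
rewrite sum_coef /slope mulrC divfK ?subrK//.
by rewrite subr_eq0 gt_eqF// node_lt// leqnn.
Qed.

End grid.

(** * Divided differences in one variable *)

Section divided_difference1.
Context {R : realType}.

Definition divided_difference1 p (x u : 'I_p.+1 -> R) : R :=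
  \sum_(j < p.+1) u j / \prod_(j' < p.+1 | j' != j) (x j - x j').

Lemma divided_difference1_0 (x u : 'I_1 -> R) :
  divided_difference1 x u = u ord0.
Proof.
by rewrite /divided_difference1 big_ord1 big_mkcond big_ord1 invr1 mulr1.
Qed.

Lemma divided_difference1_1 (x u : 'I_2 -> R) : x ord0 < x ord_max ->
  divided_difference1 x u = (u ord_max - u ord0) / (x ord_max - x ord0).
Proof.
move=> x01; rewrite /divided_difference1.
under eq_bigr do rewrite big_mkcond !big_ord_recl big_ord0 /=.
rewrite !big_ord_recl big_ord0 /=.
have <- : ord_max = lift ord0 ord0 :> 'I_2 by exact: val_inj.
by rewrite ?mulr1 ?mul1r; field; rewrite !subr_eq0 (gt_eqF x01) (lt_eqF x01).
Qed.

Lemma divided_difference1_2 (x u : 'I_3 -> R) (i := lift ord0 ord0 : 'I_3) :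
    x ord0 < x i -> x i < x ord_max ->
  divided_difference1 x u = ((u ord_max - u i) / (x ord_max - x i) -
    (u i - u ord0) / (x i - x ord0)) / (x ord_max - x ord0).
Proof.
move=> x01 x12; have x02 := lt_trans x01 x12; rewrite /divided_difference1.
under eq_bigr do rewrite big_mkcond !big_ord_recl big_ord0 /=.
rewrite !big_ord_recl big_ord0 /=.
have <- : ord_max = lift ord0 (lift ord0 ord0) :> 'I_3 by exact: val_inj.
rewrite -/i ?mulr1 ?mul1r; field.
rewrite !subr_eq0 (gt_eqF x01) (lt_eqF x01) (gt_eqF x12) (lt_eqF x12).
by rewrite (gt_eqF x02) (lt_eqF x02).
Qed.

End divided_difference1.

(** For i >= 2, a change of slope is a second divided difference times the distance of its outer
    nodes. Truncated subtraction starts the nodes at 0 when i <= 2. *)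
Lemma coefE (R : realType) (G : grid R) i l p : (i <= grid_size G)%N ->
  p = minn i 2 ->
  coef G i l = (if i is i'.+2 then node G i'.+2 - node G i' else 1) *
    divided_difference1 (fun j : 'I_p.+1 => node G (i - 2 + j))
                        (fun j : 'I_p.+1 => (l == (i - 2 + j)%N)%:R).
Proof.
have lt i' j' : (i' < j')%N -> (j' <= grid_size G)%N -> node G i' < node G j'.
  by move=> ij jm; rewrite node_lt// ij.
case: i => [|[|i]] im; rewrite ?(minn0, min0n) => ->.
- by rewrite divided_difference1_0 mul1r.
- rewrite mul1r divided_difference1_1 //=.
  by apply: lt.
- have lt01 : node G i < node G i.+1 by apply: lt => //; exact: ltnW.
  have lt12 : node G i.+1 < node G i.+2 by apply: lt.
  rewrite (_ : minn i.+2 2 = 2)%N; last exact/minn_idPr.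
  have E : (i.+2 - 2 = i)%N by rewrite subSS subSS subn0.
  rewrite divided_difference1_2 /= E ?addn0 ?addn1 ?addn2//.
  rewrite mulrC divfK// subr_eq0 gt_eqF//.
  exact: lt_trans lt12.
Qed.

(** * Expansion of a function at the points of a grid *)

Section grid_weight.
Context {R : realType} {d : nat} (f : d.-tuple R -> R) (G : grid R).
Local Notation m := (grid_size G).
Local Notation x := (node G).
Implicit Types (i j : {ffun 'I_d -> 'I_m.+1}) (S : {set 'I_d}).

Definition grid_value i : R := f [tuple x (i k) | k < d].

Definition grid_weight i : R :=
  tensor (fun k (l : 'I_m.+1) => coef G (i k) l) grid_value.

Definition interaction i : {set 'I_d} := [set k | i k != ord0].

(** The tensor product over the coordinates of [hat_interpolation]. *)
Lemma grid_value_expansion j :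
  grid_value j = \sum_i grid_weight i * \prod_k hat G (i k) (x (j k)).
Proof.
under eq_bigr do rewrite mulrC -tensorZ.
transitivity (tensor (fun k (l : 'I_m.+1) =>
  \sum_(i < m.+1) hat G i (x (j k)) * coef G i l) grid_value); last first.
  rewrite (tensor_family (fun _ : 'I_d => xpredT)
    (fun k (i : 'I_m.+1) l => hat G i (x (j k)) * coef G i l)).
  by apply: eq_bigl => i; apply/familyP.
rewrite (eq_tensor (c' := fun k l => 1 * (l == j k)%:R)); last first.
  move=> k l; under eq_bigr do rewrite mulrC.
  by rewrite hat_interpolation ?mul1r// -ltnS.
rewrite tensor_delta big1// mul1r; congr grid_value.
by apply/ffunP => k; rewrite ffunE.
Qed.

Lemma grid_divided_difference (p : 'I_d -> nat)
    (s : forall k, 'I_(p k).+1 -> 'I_m.+1) :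
  divided_difference f (fun k a => x (s k a)) =
  tensor (fun k (l : 'I_m.+1) =>
    divided_difference1 (fun a => x (s k a)) (fun a => (l == s k a)%:R))
    grid_value.
Proof.
pose e k a := (\prod_(b < (p k).+1 | b != a) (x (s k a) - x (s k b)))^-1.
rewrite (eq_tensor (c' := fun k l => \sum_a e k a * (l == s k a)%:R)).
  rewrite tensor_dffun; apply: eq_bigr => i _; rewrite mulrC prodfV.
  by congr (_ * f _); apply/eq_from_tnth => k; rewrite !tnth_mktuple ffunE.
by move=> k l; apply: eq_bigr => a _; rewrite mulrC.
Qed.

(** Up to the nonnegative factors of [coefE], the weight is a divided difference of orders min(i k,
    2), whose maximum is 2 thanks to [k0]. *)
Lemma grid_weight_le0 i (k0 : 'I_d) : totally_concave_Popoviciu f ->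
  (2 <= i k0)%N -> grid_weight i <= 0.
Proof.
move=> fC ik0; pose p k := minn (i k) 2.
have sm k (a : 'I_(p k).+1) : (i k - 2 + a < m.+1)%N.
  have ap : (a <= minn (i k) 2)%N by rewrite -ltnS; exact: ltn_ord a.
  by move: (ltn_ord (i k)) ap; move: (nat_of_ord (i k)) (nat_of_ord a); lia.
pose s k (a : 'I_(p k).+1) : 'I_m.+1 := Ordinal (sm k a).
pose w k : R := if nat_of_ord (i k) is i'.+2 then x i'.+2 - x i' else 1.
have -> : grid_weight i =
    (\prod_k w k) * divided_difference f (fun k a => x (s k a)).
  rewrite grid_divided_difference -tensorZ; apply: eq_tensor => k l.
  by apply: coefE => //; rewrite -ltnS.
apply: mulr_ge0_le0.
  apply: prodr_ge0 => k _; rewrite /w; have := ltn_ord (i k).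
  case: (nat_of_ord (i k)) => [|[|i']]//; rewrite ltnS => i'm.
  by rewrite subr_ge0 node_le// i'm andbT -addn2 leq_addr.
apply: fC.
- apply/eqP; rewrite eqn_leq; apply/andP; split.
    by apply/bigmax_leqP => k _; rewrite geq_minr.
  by apply: leq_trans (leq_bigmax k0); rewrite /p leq_min ik0.
- by move=> k a; rewrite node_itv// -ltnS.
- by move=> k a b ab; rewrite node_lt//= ltn_add2l ab -ltnS sm.
Qed.

Lemma sum_coef_neq0 (l : nat) :
  \sum_(i < m.+1 | i != ord0) coef G i l = slope G m.-1 l.
Proof.
have := sum_coef G m.-1 l; rewrite prednK ?grid_size_gt0// => <-.
by rewrite big_mkcond big_ord_recl eqxx /= add0r.
Qed.

(** The index whose product of hats is, on the cube, the monomial of [S]. *)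
Definition unit_index S : {ffun 'I_d -> 'I_m.+1} := [ffun k => inord (k \in S)].

Lemma unit_indexE S k : unit_index S k = (k \in S) :> nat.
Proof.
rewrite ffunE inordK//; case: (k \in S) => //.
by rewrite ltnS grid_size_gt0.
Qed.

Lemma grid_weight_unit S :
  grid_weight (unit_index S) = quotient_at_zero f S [tuple x 1 | _ < d].
Proof.
have one_lt : (1 < m.+1)%N by rewrite ltnS grid_size_gt0.
pose b := Ordinal one_lt.
rewrite /grid_weight (eq_tensor (c' := fun k l => if k \in S then
  (x 1)^-1 * ((l == b)%:R - (l == ord0)%:R) else (l == ord0)%:R)); last first.
  move=> k l; rewrite unit_indexE; case: (k \in S) => //=.
  by rewrite /slope node0 subr0 mulrC.
rewrite tensor_difference /quotient_at_zero; congr (_ * _).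
  by under [in RHS]eq_bigr do rewrite tnth_mktuple; rewrite prodr_const exprVn.
apply: eq_bigr => Q QS; congr (_ * f _); apply/eq_from_tnth => k.
rewrite !tnth_mktuple ffunE; case: (k \in Q); first by rewrite mulr1.
by rewrite mulr0; case: ifP => _; rewrite node0.
Qed.

(** In a coordinate of [S] the coefficients telescope to the slope on the last mesh interval;
    elsewhere only evaluation at 0 is left. *)
Lemma sum_grid_weight S :
  \sum_(i | interaction i == S) grid_weight i =
  quotient_at_one f S [tuple x m.-1 | _ < d].
Proof.
have m0 := grid_size_gt0 G.
have a_lt : (m.-1 < m.+1)%N by rewrite prednK// ltnW.
pose a := Ordinal a_lt.
transitivity (tensor (fun k (l : 'I_m.+1) =>
    \sum_(i : 'I_m.+1 | (i != ord0) == (k \in S)) coef G i l) grid_value).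
  rewrite (tensor_family (fun k (i : 'I_m.+1) => (i != ord0) == (k \in S))
    (fun k (i : 'I_m.+1) l => coef G i l)).
  apply: eq_bigl => i; apply/eqP/familyP => [<- k|iS].
    by rewrite unfold_in /= inE.
  by apply/setP => k; rewrite inE; exact: (elimT eqP (iS k)).
rewrite (eq_tensor (c' := fun k l => if k \in S then
  (1 - x m.-1)^-1 * ((l == ord_max)%:R - (l == a)%:R) else (l == ord0)%:R)).
  rewrite tensor_difference /quotient_at_one; congr (_ * _).
    under [in RHS]eq_bigr do rewrite tnth_mktuple.
    by rewrite prodr_const exprVn.
  apply: eq_bigr => Q QS; congr (_ * f _); apply/eq_from_tnth => k.
  rewrite !tnth_mktuple ffunE inE; have := fintype.subsetP QS k.
  case: (k \in Q) => [_|_] /=; first by rewrite mulr0 addr0 node_size.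
  by case: (k \in S); rewrite /= ?mulr1 ?mulr0 add0r// node0.
move=> k l; case: (k \in S).
  under eq_bigl do rewrite eqb_id.
  by rewrite sum_coef_neq0 /slope prednK// node_size mulrC.
under eq_bigl do rewrite eqbF_neg negbK.
by rewrite big_pred1_eq.
Qed.

Lemma grid_weight0 :
  grid_weight [ffun=> ord0] = f [tuple 0 | _ < d].
Proof.
rewrite /grid_weight.
rewrite (eq_tensor (c' := fun k l => 1 * (l == ord0)%:R)); last first.
  by move=> k l; rewrite ffunE mul1r.
rewrite tensor_delta big1// mul1r; congr f; apply/eq_from_tnth => k.
by rewrite !tnth_mktuple ffunE node0.
Qed.

Lemma interaction_unit S : interaction (unit_index S) = S.
Proof.
apply/setP => k; rewrite inE -val_eqE /= unit_indexE.
by case: (k \in S).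
Qed.

(** An index with all entries at most 1 is the unit index of its interaction, so here some entry is
    at least 2. *)
Lemma grid_weight_concave i : totally_concave_Popoviciu f ->
  i != unit_index (interaction i) -> grid_weight i <= 0.
Proof.
move=> fC iu.
have [/existsP[k ik]|] := boolP [exists k, (2 <= i k)%N].
  exact: (grid_weight_le0 (k0 := k)).
rewrite negb_exists => /forallP i1; case/negP: iu; apply/eqP.
apply/ffunP => k; apply/val_inj => /=; rewrite unit_indexE inE.
have := i1 k; rewrite -ltnNge ltnS -val_eqE /=.
by case: (nat_of_ord (i k)) => [|[|]].
Qed.

Definition node_point S i : #|S|.-tuple R :=
  [tuple x (i (enum_val a)).-1 | a < #|S|].

(** The discrete analogue of integration against nu_S: opposite weights are atoms at the kinks of
    the hinges. The unit index, whose kinks are all at 0, belongs to the monomial instead. *)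
Definition grid_functional S (h : #|S|.-tuple R -> R) : R :=
  \sum_(i | (interaction i == S) && (i != unit_index S))
    - grid_weight i * h (node_point S i).

Lemma node_point_cube S i : cube (node_point S i).
Proof.
move=> a; rewrite tnth_mktuple node_itv// (leq_trans (leq_pred _))//.
by rewrite -ltnS.
Qed.

Lemma grid_functional_linear S a g h :
  grid_functional (fun t => a * g t + h t) =
  a * @grid_functional S g + @grid_functional S h.
Proof. by rewrite mulr_sumr -big_split; apply: eq_bigr => i _ /=; ring. Qed.

Lemma grid_functional_ge0 S h : totally_concave_Popoviciu f ->
  (forall t, cube t -> 0 <= h t) -> 0 <= @grid_functional S h.
Proof.
move=> fC h0; apply: sumr_ge0 => i /andP[/eqP iS iu].
apply: mulr_ge0; last exact/h0/node_point_cube.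
by rewrite oppr_ge0 grid_weight_concave// iS.
Qed.

(** All weights of interaction [S] sum to the quotient at one, and that of the unit index is the
    quotient at zero. *)
Lemma grid_functional1 S : @grid_functional S (fun=> 1) =
  quotient_at_zero f S [tuple x 1 | _ < d] -
  quotient_at_one f S [tuple x m.-1 | _ < d].
Proof.
rewrite -sum_grid_weight (bigD1 (unit_index S)) ?interaction_unit//=.
rewrite grid_weight_unit opprD addrA subrr sub0r -sumrN.
by apply: eq_bigr => i _; rewrite mulr1.
Qed.

Lemma prod_hat i (y : 'I_d -> R) :
  \prod_k hat G (i k) (y k) =
  \prod_(k in interaction i) Num.max (y k - x (i k).-1) 0.
Proof.
rewrite [RHS]big_mkcond; apply: eq_bigr => k _.
rewrite inE -val_eqE /=.
by case: (nat_of_ord (i k)).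
Qed.

(** The terms are grouped by interaction: the empty set gives the constant, each unit index a
    monomial, and the other indices the functional at a hinge product. *)
Lemma grid_expansion j (y := [tuple x (j k) | k < d]) :
  f y = f [tuple 0 | _ < d]
    + \sum_(S : {set 'I_d} | S != finset.set0)
        quotient_at_zero f S [tuple x 1 | _ < d] * \prod_(k in S) tnth y k
    - \sum_(S : {set 'I_d} | S != finset.set0)
        @grid_functional S (hinge (fun a => tnth y (enum_val a))).
Proof.
rewrite -[LHS]/(grid_value j) grid_value_expansion.
rewrite (partition_big interaction xpredT)//= (bigD1 finset.set0)//= -addrA.
congr (_ + _).
  rewrite (big_pred1 [ffun=> ord0]) => [|i].
    by rewrite grid_weight0 big1 ?mulr1// => k _; rewrite ffunE.
  apply/eqP/eqP => [/setP i0|->]; last first.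
    by apply/setP => k; rewrite !inE ffunE eqxx.
  by apply/ffunP => k; have := i0 k; rewrite !inE ffunE => /negbFE/eqP.
rewrite -sumrB; apply: eq_bigr => S _.
rewrite (bigD1 (unit_index S)) ?interaction_unit//= grid_weight_unit prod_hat.
rewrite interaction_unit; congr (_ * _ + _).
  apply: eq_bigr => k kS; rewrite unit_indexE kS node0 subr0 tnth_mktuple.
  have /andP[xj0 _] : 0 <= x (j k) <= 1 by rewrite node_itv// -ltnS.
  by rewrite max_l.
rewrite -sumrN; apply: eq_bigr => i /andP[/eqP iS _].
rewrite mulNr opprK prod_hat iS; congr (_ * _).
rewrite big_enum_val; apply: eq_bigr => a _.
by rewrite !tnth_mktuple.
Qed.

End grid_weight.

(** * Divided differences of totally concave functions *)

Section concave_Popoviciu.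
Context {R : realType}.

Lemma divided_difference1_cst p (x : 'I_p.+1 -> R) : (0 < p <= 2)%N ->
  (forall i j : 'I_p.+1, (i < j)%N -> x i < x j) ->
  divided_difference1 x (fun=> 1) = 0.
Proof.
case: p x => [|[|[|//]]] x // _ xlt.
  by rewrite divided_difference1_1 ?xlt// subrr mul0r.
by rewrite divided_difference1_2 ?xlt// !subrr !mul0r subrr mul0r.
Qed.

Lemma divided_difference1_id (x : 'I_3 -> R) :
  (forall i j : 'I_3, (i < j)%N -> x i < x j) -> divided_difference1 x x = 0.
Proof.
move=> xlt; rewrite divided_difference1_2 ?xlt// !divff ?subrr ?mul0r//.
  by rewrite subr_eq0 gt_eqF// xlt.
by rewrite subr_eq0 gt_eqF// xlt.
Qed.

Lemma divided_difference1_cst_ge0 p (x : 'I_p.+1 -> R) : (p <= 2)%N ->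
  (forall i j : 'I_p.+1, (i < j)%N -> x i < x j) ->
  0 <= divided_difference1 x (fun=> 1).
Proof.
move=> p2 xlt; have [p0|p0] := posnP p.
  by subst p; rewrite divided_difference1_0.
by rewrite divided_difference1_cst// p0.
Qed.

(** Orders 0, 1 and 2 express that the hinge is nonnegative, nondecreasing and convex. *)
Lemma divided_difference1_max0_ge0 p (x : 'I_p.+1 -> R) (t : R) : (p <= 2)%N ->
  (forall i j : 'I_p.+1, (i < j)%N -> x i < x j) ->
  0 <= divided_difference1 x (fun j => Num.max (x j - t) 0).
Proof.
case: p x => [|[|[|//]]] x // _ xlt.
- by rewrite divided_difference1_0 le_max lexx orbT.
- have lt01 := xlt ord0 ord_max isT.
  rewrite divided_difference1_1// divr_ge0 ?subr_ge0 ?(ltW lt01)//.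
  by case: (leP (x ord0 - t) 0); case: (leP (x ord_max - t) 0) => *; lra.
pose i : 'I_3 := lift ord0 ord0.
have lt01 : x ord0 < x i by apply: xlt.
have lt12 : x i < x ord_max by apply: xlt.
have lt02 := lt_trans lt01 lt12.
rewrite divided_difference1_2 -/i// divr_ge0 ?subr_ge0 ?(ltW lt02)//.
rewrite ler_pdivrMr ?subr_gt0// mulrAC ler_pdivlMr ?subr_gt0//.
case: (leP (x ord0 - t) 0); case: (leP (x i - t) 0);
  case: (leP (x ord_max - t) 0) => *; nra.
Qed.

Variables (d : nat) (p : 'I_d -> nat) (x : forall k : 'I_d, 'I_(p k).+1 -> R).
Arguments x : clear implicits.

Definition dd_node (i : {dffun forall k : 'I_d, 'I_(p k).+1}) : d.-tuple R :=
  [tuple x k (i k) | k < d].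

Definition dd_coef (i : {dffun forall k : 'I_d, 'I_(p k).+1}) : R :=
  (\prod_(k < d) \prod_(j < (p k).+1 | j != i k) (x k (i k) - x k j))^-1.

Lemma divided_differenceE f :
  divided_difference f x = \sum_i dd_coef i * f (dd_node i).
Proof. by apply: eq_bigr => i _; rewrite mulrC. Qed.

Lemma divided_difference_prod (g : 'I_d -> R -> R) :
  \sum_i dd_coef i * \prod_k g k (tnth (dd_node i) k) =
  \prod_k divided_difference1 (x k) (fun j => g k (x k j)).
Proof.
rewrite prod_sum_dffun; apply: eq_bigr => i _.
rewrite big_split mulrC prodfV; congr (_ * _).
by apply: eq_bigr => k _; rewrite tnth_mktuple.
Qed.

Hypothesis p2 : (\max_(k < d) p k = 2)%N.
Hypothesis x01 : forall k i, 0 <= x k i <= 1.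
Hypothesis x_lt : forall k (i j : 'I_(p k).+1), (i < j)%N -> x k i < x k j.

Lemma dd_node_cube i : cube (dd_node i).
Proof. by move=> k; rewrite tnth_mktuple. Qed.

Lemma order_le2 k : (p k <= 2)%N.
Proof. by rewrite -p2 leq_bigmax. Qed.

Lemma order_eq2 : exists k, p k = 2%N.
Proof.
apply: contrapT => nex; have : (\max_(k < d) p k <= 1)%N.
  apply/bigmax_leqP => k _; have := order_le2 k.
  by rewrite leq_eqVlt => /predU1P[pk|//]; case: nex; exists k.
by rewrite p2.
Qed.

(** In a coordinate of order 2 the factor is 1 or the identity, and both have zero second divided
    difference. *)
Lemma divided_difference_monomial (S : {set 'I_d}) :
  \sum_i dd_coef i * \prod_(k in S) tnth (dd_node i) k = 0.
Proof.
under eq_bigr do rewrite big_mkcond /=.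
rewrite (divided_difference_prod (fun k y => if k \in S then y else 1)).
have [k pk] := order_eq2; rewrite (bigD1 k)//=.
suff -> : divided_difference1 (x k) (fun j => if k \in S then x k j else 1) = 0.
  by rewrite mul0r.
case: (k \in S); last first.
  by apply: divided_difference1_cst; rewrite ?pk//; exact: x_lt.
move: (x k) (@x_lt k); rewrite pk; exact: divided_difference1_id.
Qed.

Lemma divided_difference_hinge_ge0 (S : {set 'I_d}) (t : #|S|.-tuple R) :
  0 <= \sum_i dd_coef i * hinge (fun a => tnth (dd_node i) (enum_val a)) t.
Proof.
(* Transports [t] from the enumeration of [S] to all coordinates: the sum has one term on [S] and
   none off it. *)
pose s (k : 'I_d) : R := \sum_(a < #|S| | enum_val a == k) tnth t a.
have sE (a : 'I_#|S|) : s (enum_val a) = tnth t a.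
  rewrite /s (big_pred1 a)// => b; exact: (inj_eq enum_val_inj).
have hE i : hinge (fun a => tnth (dd_node i) (enum_val a)) t =
    \prod_k (if k \in S then Num.max (tnth (dd_node i) k - s k) 0 else 1).
  rewrite -big_mkcond /= big_enum_val; apply: eq_bigr => a _.
  by rewrite sE.
under eq_bigr do rewrite hE.
rewrite (divided_difference_prod
  (fun k y => if k \in S then Num.max (y - s k) 0 else 1)).
apply: prodr_ge0 => k _; have pk := order_le2 k.
case: (k \in S).
  by apply: divided_difference1_max0_ge0 => //; exact: x_lt.
by apply: divided_difference1_cst_ge0 => //; exact: x_lt.
Qed.

End concave_Popoviciu.

Lemma Rintegral_sum d (T : measurableType d) (R : realType)
    (mu : {measure set T -> \bar R}) (D : set T) (I : Type) (r : seq I)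
    (c : I -> R) (g : I -> T -> R) :
  measurable D -> (forall i, mu.-integrable D (EFin \o g i)) ->
  \int[mu]_(t in D) (\sum_(i <- r) c i * g i t) =
  \sum_(i <- r) c i * \int[mu]_(t in D) g i t.
Proof.
move=> mD ig.
have icg i : mu.-integrable D (fun t => (c i * g i t)%:E).
  by under eq_fun do rewrite EFinM; exact: integrableZl (ig i).
rewrite /Rintegral; under eq_integral do rewrite -sumEFin.
rewrite integral_sum//.
have E i : (\int[mu]_(t in D) (c i * g i t)%:E =
    (c i * \int[mu]_(t in D) g i t)%:E)%E.
  under eq_integral do rewrite EFinM.
  rewrite (integralZl mD (ig i)) EFinM; congr (_ * _)%E.
  by rewrite /Rintegral fineK//; exact: integrable_fin_num (ig i).
by under eq_bigr do rewrite E; rewrite sumEFin.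
Qed.

(** Divided differences annihilate the constant and the monomials. They pass under the integrals,
    where those of hinge products are nonnegative. *)
Lemma totally_concaveW (R : realType) d (f : d.-tuple R -> R) :
  totally_concave f -> totally_concave_Popoviciu f.
Proof.
move=> [b0 [b [nu fE]]] p p2 x x01 x_lt.
rewrite divided_differenceE.
under eq_bigr => i _ do rewrite (fE _ (dd_node_cube x01 i)) mulrBr mulrDr.
rewrite sumrB big_split /=.
have -> : \sum_i dd_coef x i * b0 = 0.
  rewrite -mulr_suml.
  have := divided_difference_monomial p2 x_lt finset.set0.
  by under eq_bigr do rewrite big_set0 mulr1; move=> ->; rewrite mul0r.
under eq_bigr do rewrite mulr_sumr.
rewrite exchange_big /= big1 => [|S _]; last first.
  under eq_bigr do rewrite mulrCA.
  by rewrite -mulr_sumr divided_difference_monomial// mulr0.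
rewrite !add0r oppr_le0.
under eq_bigr do rewrite mulr_sumr.
rewrite exchange_big /=; apply: sumr_ge0 => S _.
have mP := @measurable_punctured_cube R #|S|.
rewrite -(@Rintegral_sum _ _ _ _ _ _ _ (dd_coef x)
  (fun i => hinge (fun a => tnth (dd_node x i) (enum_val a))))//; last first.
  move=> i; apply: integrable_bounded_on_cube => //.
  - exact: punctured_cube_sub.
  - exact: measurable_hinge.
  - by apply: bounded_on_cube_hinge => a; exact: dd_node_cube.
by apply: Rintegral_ge0 => t _; exact: divided_difference_hinge_ge0.
Qed.

(** * Passage to the limit along finer grids *)

(** For each [A], the ultrafilter contains the preimage of [A] or that of its complement, so the
    image filter has no strictly finer proper filter. *)
Lemma ultra_fmap (T U : Type) (F : set_system T) (v : T -> U) :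
  UltraFilter F -> UltraFilter (v @ F).
Proof.
move=> FU; split; first exact: fmap_proper_filter.
move=> H HF FH; rewrite predeqE => A; split; last exact: FH.
move=> HA; have [//|FnA] := in_ultra_setVsetC (v @^-1` A) FU.
have nA : H (~` A) by apply: FH; rewrite /= /fmap /= preimage_setC.
by have /filter_ex [? []] : H (A `&` ~` A) by exact: filterI.
Qed.

(** The image ultrafilter contains the compact segment [- C, C], hence converges. *)
Lemma ultra_cvg (R : realType) (T : Type) (F : set_system T) (v : T -> R)
    (C : R) :
  UltraFilter F -> (forall t, `|v t| <= C) -> v @ F --> lim (v @ F).
Proof.
move=> FU vC; have := @segment_compact R (- C) C; rewrite compact_ultra.
move=> /(_ (v @ F) (ultra_fmap v FU)) [|l [_ vl]]; last first.
  exact: cvgP vl.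
suff : F (v @^-1` `[- C, C]) by [].
by apply: filterE => t /=; rewrite in_itv /= -ler_norml; exact: vC.
Qed.

Lemma cvg_sumr (R : realType) (T : Type) (F : set_system T) (I : Type)
    (r : seq I) (P : pred I) (v : I -> T -> R) (l : I -> R) :
  Filter F -> (forall i, P i -> v i @ F --> l i) ->
  (fun t => \sum_(i <- r | P i) v i t) @ F --> \sum_(i <- r | P i) l i.
Proof.
move=> FF vl; elim: r => [|i r IH].
  under eq_fun do rewrite big_nil; rewrite big_nil; exact: cvg_cst.
rewrite big_cons; under eq_fun do rewrite big_cons.
by case: ifPn => // Pi; apply: cvgD => //; exact: vl.
Qed.

(** * An ultrafilter of grids *)

Section grid_filter.
Context {R : realType}.

Definition has_nodes (s : seq R) : set (grid R) :=
  [set G | forall y, y \in s -> 0 <= y <= 1 ->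
    exists j : 'I_(grid_size G).+1, node G j = y].

Lemma has_nodes_nonempty (s : seq R) : has_nodes s !=set0.
Proof.
(* The endpoints are added, and duplicates removed to make the nodes strictly increasing. *)
pose g := sort <=%O (undup (0 :: 1 :: [seq y <- s | 0 <= y <= 1])).
have g_lt : sorted <%O g by rewrite sort_lt_sorted undup_uniq.
have memg y : (y \in g) = [|| y == 0, y == 1 | (0 <= y <= 1) && (y \in s)].
  by rewrite mem_sort mem_undup !inE mem_filter.
have g01 y : y \in g -> 0 <= y <= 1.
  by rewrite memg => /or3P[/eqP ->|/eqP ->|/andP[]//]; rewrite ?lexx ler01.
have g0 : (0 : R) \in g by rewrite memg eqxx.
have g1 : (1 : R) \in g by rewrite memg eqxx orbT.
have sg : (size g).-1.+1 = size g by case: (g) g0.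
have gsm : ((size g).-1 < size g)%N by rewrite -sg leqnn.
have nth_le i j : (i <= j)%N -> (j < size g)%N -> nth 0 g i <= nth 0 g j.
  by move=> ij jg; rewrite (lt_sorted_leq_nth _ g_lt)// inE (leq_ltn_trans ij).
have n0 : nth 0 g 0 = 0.
  apply/eqP; rewrite eq_le; apply/andP; split.
    by rewrite -[leRHS](nth_index 0 g0) nth_le// index_mem.
  by have /andP[] := g01 _ (mem_nth 0 (leq_ltn_trans (leq0n _) gsm)).
have n1 : nth 0 g (size g).-1 = 1.
  apply/eqP; rewrite eq_le; apply/andP; split.
    by have /andP[] := g01 _ (mem_nth 0 gsm).
  by rewrite -[leLHS](nth_index 0 g1) nth_le// -ltnS sg index_mem.
have m0 : (0 < (size g).-1)%N.
  rewrite lt0n; apply/eqP => E; move: n1; rewrite E n0 => /eqP.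
  by rewrite eq_sym oner_eq0.
have n_lt i j : (i < j <= (size g).-1)%N -> nth 0 g i < nth 0 g j.
  move=> /andP[ij]; rewrite -ltnS sg => jg.
  by rewrite (lt_sorted_ltn_nth _ g_lt)// inE (ltn_trans ij).
exists (Grid m0 n0 n1 n_lt) => y ys y01 /=.
have yg : y \in g by rewrite memg y01 ys !orbT.
have yi : (index y g < (size g).-1.+1)%N by rewrite sg index_mem.
by exists (Ordinal yi) => /=; rewrite nth_index.
Qed.

(** The condition for a concatenation implies those for both lists, so the sets [has_nodes s]
    generate a proper filter, which an ultrafilter refines. *)
Lemma grid_ultrafilter : exists2 F : set_system (grid R),
  UltraFilter F & forall s, F (has_nodes s).
Proof.
have FF : Filter (filter_from [set: seq R] has_nodes).
  apply: filter_fromT_filter; first by exists [::].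
  move=> s t; exists (s ++ t) => G Gst.
  by split=> y ys; apply: Gst; rewrite mem_cat ys ?orbT.
have FP : ProperFilter (filter_from [set: seq R] has_nodes).
  by apply: filter_from_proper => // s _; exact: has_nodes_nonempty.
have [F [FU sF]] := ultraFilterLemma FP.
by exists F => // s; apply: sF; exists s.
Qed.

End grid_filter.

(** * Uniform bounds and representation of the limit *)

Lemma ereal_sup_lty_ub (R : realType) (T : Type) (A : set T) (g : T -> R) :
  (ereal_sup [set (g t)%:E | t in A] < +oo)%E ->
  exists C, forall t, A t -> g t <= C.
Proof.
move=> sup_lt; exists (fine (ereal_sup [set (g t)%:E | t in A])) => t At.
have : ((g t)%:E <= ereal_sup [set (g t)%:E | t in A])%E.
  by apply: ereal_sup_ubound; exists t.
by move: sup_lt; case: ereal_sup.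
Qed.

Lemma ereal_inf_gtNy_lb (R : realType) (T : Type) (A : set T) (g : T -> R) :
  (ereal_inf [set (g t)%:E | t in A] > -oo)%E ->
  exists C, forall t, A t -> C <= g t.
Proof.
move=> inf_gt; exists (fine (ereal_inf [set (g t)%:E | t in A])) => t At.
have : (ereal_inf [set (g t)%:E | t in A] <= (g t)%:E)%E.
  by apply: ereal_inf_lbound; exists t.
by move: inf_gt; case: ereal_inf.
Qed.

Section limit_representation.
Context {R : realType} {d : nat} (f : d.-tuple R -> R).
Hypothesis fC : totally_concave_Popoviciu f.
Variables (S : {set 'I_d}) (A B : R).
Hypothesis le_B : forall t : d.-tuple R,
  (forall k, k \in S -> 0 < tnth t k <= 1) -> quotient_at_zero f S t <= B.
Hypothesis ge_A : forall t : d.-tuple R,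
  (forall k, k \in S -> 0 <= tnth t k < 1) -> A <= quotient_at_one f S t.

Let slope0 (G : grid R) : R := quotient_at_zero f S [tuple node G 1 | _ < d].
Let slope1 (G : grid R) : R :=
  quotient_at_one f S [tuple node G (grid_size G).-1 | _ < d].

Lemma grid_functional_positive G :
  positive_functional (@grid_functional R d f G S).
Proof.
split=> [a g h _ _|h _]; first exact: grid_functional_linear.
exact: grid_functional_ge0.
Qed.

Lemma slope0_le G : slope0 G <= B.
Proof.
apply: le_B => k _; rewrite tnth_mktuple -{1}(node0 G).
rewrite node_lt ?grid_size_gt0//=.
by have /andP[] := node_itv (grid_size_gt0 G).
Qed.

Lemma slope1_ge G : A <= slope1 G.
Proof.
apply: ge_A => k _; rewrite tnth_mktuple -(node_size G).
rewrite node_lt ?prednK ?grid_size_gt0 ?leqnn// andbT.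
by have /andP[] := node_itv (leq_pred (grid_size G)).
Qed.

Lemma slope1_le_slope0 G : slope1 G <= slope0 G.
Proof.
rewrite -subr_ge0 -grid_functional1.
by apply: grid_functional_ge0 => // t _; exact: ler01.
Qed.

(** The one-sided regularity bounds become two-sided through A <= slope1 <= slope0 <= B, the middle
    inequality being positivity of the total mass. *)
Lemma slope0_bounded G : `|slope0 G| <= `|A| + `|B|.
Proof.
have := slope0_le G; have := slope1_le_slope0 G; have := slope1_ge G.
have := ler_norm B; have := ler_norm (- A); rewrite normrN.
have := normr_ge0 A; have := normr_ge0 B.
by move=> *; rewrite ler_norml; apply/andP; split; lra.
Qed.

(** The total mass [slope0 G - slope1 G] is at most B - A on every grid. *)
Lemma grid_functional_bounded (h : #|S|.-tuple R -> R) C :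
  (forall t, cube t -> `|h t| <= C) ->
  forall G, `|@grid_functional R d f G S h| <= `|C| * (B - A).
Proof.
move=> hC G; have hC' t : cube t -> `|h t| <= `|C|.
  by move=> /hC; have := ler_norm C; lra.
apply: le_trans (pf_norm_le (grid_functional_positive G) hC') _.
rewrite ler_wpM2l// grid_functional1 -/(slope0 G) -/(slope1 G).
by have := slope0_le G; have := slope1_ge G; lra.
Qed.

Variable F : set_system (grid R).
Hypothesis FU : UltraFilter F.

Let limit_functional (h : #|S|.-tuple R -> R) : R :=
  lim (@grid_functional R d f G S h @[G --> F]).

Lemma cvg_limit_functional h : bounded_on_cube h ->
  @grid_functional R d f G S h @[G --> F] --> limit_functional h.
Proof. by move=> [C hC]; exact: ultra_cvg (grid_functional_bounded hC). Qed.

Lemma limit_functional_positive : positive_functional limit_functional.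
Proof.
split=> [a g h gb hb|h hb h0].
  apply: (@cvg_unique _ (@norm_hausdorff _ R) (@grid_functional R d f G S
    (fun x => a * g x + h x) @[G --> F])).
    exact/cvg_limit_functional/bounded_on_cube_linear.
  rewrite (_ : (fun G => _) = (fun G => a * @grid_functional R d f G S g +
    @grid_functional R d f G S h)); last first.
    by apply/funext => G; exact: grid_functional_linear.
  by apply: cvgD; [apply: cvgMl_tmp|]; exact: cvg_limit_functional.
apply: limr_ge; first by apply: cvgP; exact: cvg_limit_functional.
by apply: nearW => G; exact: grid_functional_ge0.
Qed.

(** Coefficient and measure form one pair, so that a single choice for each [S] provides both. *)
Lemma limit_representation :
  exists bnu : R * {finite_measure set (#|S|.-tuple R) -> \bar R},
    forall z : 'I_#|S| -> R, (forall a, 0 <= z a <= 1) ->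
    (slope0 G * \prod_a z a - @grid_functional R d f G S (hinge z))
      @[G --> F] -->
    bnu.1 * \prod_a z a -
      \int[bnu.2]_(t in @punctured_cube R #|S|) hinge z t.
Proof.
have [nu nuE] := pf_representation limit_functional_positive.
pose o : #|S|.-tuple R := [tuple 0 | _ < #|S|].
(* At the origin the hinge product equals the monomial, so the atom there is subtracted from the
   coefficient. *)
exists (lim (slope0 @ F) - fine (nu [set o]), nu) => z z01 /=.
have hb := bounded_on_cube_hinge z01.
have -> : (lim (slope0 @ F) - fine (nu [set o])) * \prod_a z a -
    \int[nu]_(t in @punctured_cube R #|S|) hinge z t =
    lim (slope0 @ F) * \prod_a z a - limit_functional (hinge z).
  rewrite nuE//; [|exact: measurable_hinge|exact: uniformly_continuous_hinge].
  rewrite Rintegral_cube//; last 2 first.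
  - exact: measurable_hinge.
  (* On a face t_k = 1 the factor (z_k - 1)_+ vanishes. *)
  - move=> t tc [k tk]; rewrite /hinge (bigD1 k)//= tk max_r ?mul0r//.
    by rewrite subr_le0; have /andP[] := z01 k.
  have -> : hinge z o = \prod_a z a.
    apply: eq_bigr => a _; rewrite tnth_mktuple subr0 max_l//.
    by have /andP[] := z01 a.
  by ring.
apply: cvgB; last exact: cvg_limit_functional.
by apply: cvgMr_tmp; exact: ultra_cvg slope0_bounded.
Qed.

End limit_representation.

Theorem proposition1 (R : realType) (d : nat) (hd : (1 <= d)%N) :
  (forall f : d.-tuple R -> R,
     totally_concave f -> totally_concave_Popoviciu f) /\
  (forall f : d.-tuple R -> R,
     totally_concave_Popoviciu f ->
     (forall S : {set 'I_d}, S != finset.set0 ->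
        (ereal_sup [set (quotient_at_zero f S t)%:E
           | t in [set t : d.-tuple R |
                    forall k, k \in S -> (0 < tnth t k <= 1)%R]] < +oo)%E /\
        (ereal_inf [set (quotient_at_one f S t)%:E
           | t in [set t : d.-tuple R |
                    forall k, k \in S -> (0 <= tnth t k < 1)%R]] > -oo)%E) ->
     totally_concave f).
Proof.
split=> [f|f fC reg]; first exact: totally_concaveW.
have [F FU Fnodes] := @grid_ultrafilter R.
pose represents (S : {set 'I_d})
    (bnu : R * {finite_measure set (#|S|.-tuple R) -> \bar R}) :=
  forall z : 'I_#|S| -> R, (forall a, 0 <= z a <= 1) ->
    (quotient_at_zero f S [tuple node G 1 | _ < d] * \prod_a z a -
      @grid_functional R d f G S (hinge z)) @[G --> F] -->
    bnu.1 * \prod_a z a -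
      \int[bnu.2]_(t in @punctured_cube R #|S|) hinge z t.
(* Stated for every [S], with a dummy pair for the empty set, so that choice gives total
   families. *)
have rep (S : {set 'I_d}) : exists bnu, S != finset.set0 -> @represents S bnu.
  have [S0|S0] := eqVneq S finset.set0.
    exists (0, (mzero : {finite_measure set (#|S|.-tuple R) -> \bar R})).
    by move=> /eqP.
  have [/ereal_sup_lty_ub[B le_B] /ereal_inf_gtNy_lb[A ge_A]] := reg _ S0.
  have [bnu bnuP] := limit_representation fC le_B ge_A FU.
  by exists bnu => _; exact: bnuP.
pose bnu (S : {set 'I_d}) := projT1 (cid (rep S)).
have bnuP (S : {set 'I_d}) : S != finset.set0 -> represents S (bnu S).
  exact: (projT2 (cid (rep S))).
exists (f [tuple 0 | _ < d]), (fun S => (bnu S).1), (fun S => (bnu S).2).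
move=> y yc; rewrite -addrA -sumrB.
pose z (S : {set 'I_d}) (a : 'I_#|S|) := tnth y (enum_val a).
have zE (S : {set 'I_d}) : \prod_(k in S) tnth y k = \prod_a z S a.
  by rewrite big_enum_val.
(* Both sides of the identity are limits along [F] of the grid expansion at [y], which eventually
   equals [f y]. *)
apply: (@cvg_unique _ (@norm_hausdorff _ R) ((fun=> f y) @ F)).
  exact: cvg_cst.
pose term G (S : {set 'I_d}) := quotient_at_zero f S [tuple node G 1 | _ < d] *
  \prod_a z S a - @grid_functional R d f G S (hinge (z S)).
apply: (@cvg_trans _ ((fun G => f [tuple 0 | _ < d] +
    \sum_(S : {set 'I_d} | S != finset.set0) term G S) @ F)).
  (* Here [y] is read as the list of its coordinates, all of them nodes eventually along [F]; on
     such grids the expansion is exact at [y]. *)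
  apply: near_eq_cvg; apply: filterS (Fnodes y) => G yG.
  have yn k : exists j : 'I_(grid_size G).+1, node G j = tnth y k.
    by apply: yG; [exact: mem_tnth|exact: yc].
  pose j := [ffun k => projT1 (cid (yn k))].
  have yE : y = [tuple node G (j k) | k < d].
    apply/eq_from_tnth => k; rewrite tnth_mktuple ffunE.
    by rewrite (projT2 (cid (yn k))).
  apply/esym; rewrite {1}yE grid_expansion -yE -addrA -sumrB.
  by congr (_ + _); apply: eq_bigr => S _; rewrite /term zE.
apply: cvgD; first exact: cvg_cst.
apply: cvg_sumr => S S0; rewrite zE; apply: bnuP => // a; exact: yc.
Qed.
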